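(* For every integer $n\geq 2$, \[BR(C_8,C_{2n})=\begin{cases} 8 & n=4,\\ n+3 & \text{otherwise.}\end{cases}\]
   Context: $C_m$ denotes the cycle on $m$ vertices and $K_{b,b}$ the complete bipartite graph with both parts of size $b$. For bipartite graphs $G_1,G_2$, the bipartite Ramsey number $BR(G_1,G_2)$ is the smallest positive integer $b$ such that for every 2-edge-coloring of $K_{b,b}$ with colors 1 and 2, there is a subgraph isomorphic to $G_1$ all of whose edges have color 1, or a subgraph isomorphic to $G_2$ all of whose edges have color 2. *)

(* Defs.v *)
From mathcomp Require Import all_boot.

Set Implicit Arguments.
Unset Strict Implicit.
Unset Printing Implicit Defensive.

Record sgraph := SGraph {
  vertex :> finType;
  adj : rel vertex;
  adj_sym : symmetric adj;
  adj_irr : irreflexive adj }.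

(** [ordS i] is [i + 1] modulo [m]; the disequality only matters for [m = 1],
    where it excludes a loop. This is the cycle C_m for [m >= 3]. *)
Definition cycle_adj (m : nat) : rel 'I_m :=
  fun i j => (i != j) && ((j == ordS i) || (i == ordS j)).

Lemma cycle_adj_sym m : symmetric (@cycle_adj m).
Proof. by move=> i j; rewrite /cycle_adj eq_sym orbC. Qed.

Lemma cycle_adj_irr m : irreflexive (@cycle_adj m).
Proof. by move=> i; rewrite /cycle_adj eqxx. Qed.

Definition cycle_graph (m : nat) : sgraph :=
  SGraph (@cycle_adj_sym m) (@cycle_adj_irr m).

Definition Kbip_adj (a b : nat) : rel ('I_a + 'I_b) :=
  fun x y => match x, y with
             | inl _, inr _ | inr _, inl _ => true
             | _, _ => false
             end.

Lemma Kbip_adj_sym a b : symmetric (@Kbip_adj a b).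
Proof. by case=> x [] y. Qed.

Lemma Kbip_adj_irr a b : irreflexive (@Kbip_adj a b).
Proof. by case. Qed.

Definition Kbip (a b : nat) : sgraph :=
  SGraph (@Kbip_adj_sym a b) (@Kbip_adj_irr a b).

Variant color := color1 | color2.

(** A 2-edge-coloring of [G] is given by a symmetric function on pairs of
    vertices, of which only the values at adjacent pairs are ever used. *)
Record edge_coloring (G : sgraph) := EdgeColoring {
  color_of :> G -> G -> color;
  color_of_sym : forall x y, color_of x y = color_of y x }.

(** [G] has a subgraph isomorphic to [H] (the image of [f], with the images of
    the edges of [H] as edges) all of whose edges have color [k]. *)
Definition has_mono_copy (G : sgraph) (c : edge_coloring G) (k : color)
    (H : sgraph) : Prop :=
  exists f : H -> G, injective f /\
    forall x y, adj x y -> adj (f x) (f y) /\ c (f x) (f y) = k.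

Definition bip_arrows (b : nat) (G1 G2 : sgraph) : Prop :=
  forall c : edge_coloring (Kbip b b),
    has_mono_copy c color1 G1 \/ has_mono_copy c color2 G2.

(** [is_BR G1 G2 b] says that BR(G1, G2) exists and equals [b]. *)
Definition is_BR (G1 G2 : sgraph) (b : nat) : Prop :=
  [/\ 0 < b, bip_arrows b G1 G2
    & forall b', 0 < b' -> bip_arrows b' G1 G2 -> b <= b'].

(* Main.v *)
From Stdlib Require Import Ascii String.
Require Import Defs.
From mathcomp Require Import all_boot.

Set Implicit Arguments.
Unset Strict Implicit.
Unset Printing Implicit Defensive.

(** Call color 1 red and color 2 blue.

    Lower bounds: if exactly the edges at three vertices of one side are red,
    then a red cycle meets that side in at most three vertices and a blue one in
    the remaining ones; and [K_{7,7}] has a coloring in which every block of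
    either color has a side with at most three vertices.

    Upper bounds: suppose that there is no red [C_8] and that [m >= 4]. Given a
    blue [C_{2m}] in [K_{m+4,m+4}], take eight consecutive vertices of it and
    the 4 + 4 vertices off the cycle. In this [K_{8,8}] the blue path on the
    eight vertices can always be replaced by a blue path on ten vertices with
    the same ends, so there is a blue [C_{2m+2}]. The claim about [K_{8,8}] does
    not depend on [m] and is settled by a finite search, which is short because
    the [K_{4,4}] off the cycle, having no red [C_8], contains a blue [C_4],
    [K_{1,3}] or [C_6]. In the same way one finds a blue [C_4] in [K_{5,5}],
    from it a blue [C_6] in [K_{6,6}], and a blue [C_8] in [K_{8,8}] from
    disjoint blue [C_6] and [C_4]. *)

(** * Paths and cycles in a bipartite relation *)

Definition flip2 (A B : Type) (r : A -> B -> bool) : B -> A -> bool :=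
  fun y x => r x y.

(** In the upper bound [r] is the red relation, so that [non r] is the blue one. *)
Definition non (A B : Type) (r : A -> B -> bool) : A -> B -> bool :=
  fun x y => ~~ r x y.

(** The vertices of the path are [a, v_0, u_0, v_1, u_1, ..., b], with
    [a :: u] on the left side and [rcons v b] on the right side. *)
Fixpoint bipath (A B : Type) (r : A -> B -> bool) (a : A) (u : seq A)
    (v : seq B) (b : B) : bool :=
  match u, v with
  | [::], [::] => r a b
  | a' :: u', b' :: v' => [&& r a b', r a' b' & bipath r a' u' v' b]
  | _, _ => false
  end.

Lemma bipath_size (A B : Type) (r : A -> B -> bool) a u v b :
  bipath r a u v b -> size v = size u.
Proof.
by elim: u a v => [|a' u IH] a [|b' v] //= /and3P[_ _ /IH ->].
Qed.

Lemma bipath_cat (A B : Type) (r : A -> B -> bool) a u1 a2 u2 v1 b1 v2 b :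
  size u1 = size v1 ->
  bipath r a (u1 ++ a2 :: u2) (v1 ++ b1 :: v2) b =
  [&& bipath r a u1 v1 b1, r a2 b1 & bipath r a2 u2 v2 b].
Proof.
elim: u1 a v1 => [|a' u1 IH] a [|b' v1] //= [] eq_sz.
by rewrite IH // -!andbA.
Qed.

Lemma bipath_rcons (A B : Type) (r : A -> B -> bool) a u a' v b' b :
  size u = size v ->
  bipath r a (rcons u a') (rcons v b') b =
  [&& bipath r a u v b', r a' b' & r a' b].
Proof. by move=> eq_sz; rewrite -!cats1 bipath_cat. Qed.

Lemma bipath_rev (A B : Type) (r : A -> B -> bool) a u v b :
  bipath r a u v b -> bipath (flip2 r) b (rev v) (rev u) a.
Proof.
elim: u a v => [|a' u IH] a [|b' v] //= /and3P[rab' ra'b' pth].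
have eq_sz := bipath_size pth.
by rewrite !rev_cons bipath_rcons ?size_rev ?IH //= /flip2 ra'b'.
Qed.

Lemma bipath_map (A B A' B' : Type) (f : A -> A') (g : B -> B')
    (r : A -> B -> bool) (r' : A' -> B' -> bool) a u v b :
  (forall x y, r x y -> r' (f x) (g y)) ->
  bipath r a u v b -> bipath r' (f a) (map f u) (map g v) (g b).
Proof.
move=> rr'; elim: u a v => [|a' u IH] a [|b' v] //=; first exact: rr'.
by case/and3P=> /rr' -> /rr' -> /IH.
Qed.

Lemma bipath_dom (A B : eqType) (r : A -> B -> bool) a u v b :
  bipath r a u v b ->
  (forall x, x \in a :: u -> exists y, r x y) /\
  (forall y, y \in b :: v -> exists x, r x y).
Proof.
elim: u a v => [|a' u IH] a [|b' v] //=.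
  by move=> rab; split=> z; rewrite inE => /eqP->; [exists b | exists a].
case/and3P=> rab' ra'b' /IH[IHa IHb]; split=> z; rewrite inE.
  by case/predU1P=> [->|/IHa //]; exists b'.
rewrite inE orbCA; case/predU1P=> [->|zbv]; first by exists a.
by apply: IHb; rewrite inE.
Qed.

Definition bicycle (A B : eqType) (r : A -> B -> bool) a u v b :=
  [&& uniq (a :: u), uniq (b :: v), bipath r a u v b & r a b].

(** The length is counted on one side: for [k >= 2] this is a cycle on [2 * k] vertices, so that
    [k = 4] means $C_8$. *)
Definition has_bicycle (A B : eqType) (r : A -> B -> bool) (k : nat) :=
  exists a u v b, (size u).+1 = k /\ bicycle r a u v b.

(** The path is read backwards. This allows a case to be settled by exchanging the two sides of the
    board. *)
Lemma has_bicycle_flip (A B : eqType) (r : A -> B -> bool) k :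
  has_bicycle (flip2 r) k -> has_bicycle r k.
Proof.
case=> [b [v [u [a [sz_v /and4P[ub ua pth rab]]]]]].
exists a, (rev u), (rev v), b; have eq_sz := bipath_size pth.
rewrite size_rev eq_sz; split=> //; apply/and4P; split=> //.
- by move: ua; rewrite /= rev_uniq mem_rev.
- by move: ub; rewrite /= rev_uniq mem_rev.
- exact: bipath_rev pth.
Qed.

(** * Refutation of two-colored boards *)

(* [if] is used instead of [&&] and [||] throughout the computational part:
   call-by-value evaluation does not short-circuit the boolean connectives. *)

Fixpoint memn (x : nat) (s : seq nat) : bool :=
  if s is y :: s' then if eqn x y then true else memn x s' else false.

Fixpoint hasn (p : nat -> bool) (s : seq nat) : bool :=
  if s is y :: s' then if p y then true else hasn p s' else false.

Lemma memnE x s : memn x s = (x \in s).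
Proof. by elim: s => //= y s ->; rewrite inE -eqnE; case: eqn. Qed.

Lemma hasnP (p : pred nat) s : reflect (exists2 x, x \in s & p x) (hasn p s).
Proof.
suff ->: hasn p s = has p s by exact: hasP.
by elim: s => //= y s ->; case: (p y).
Qed.

(** The adjacency lists of the rows and of the columns. *)
Definition graph : Type := (seq (seq nat) * seq (seq nat))%type.

Definition neighbours (l : seq (seq nat)) (i : nat) : seq nat := nth [::] l i.

Definition insert (i j : nat) (l : seq (seq nat)) :=
  set_nth [::] l i (j :: neighbours l i).

Definition add_edge (g : graph) (i j : nat) : graph :=
  (insert i j g.1, insert j i g.2).

Definition graph_of (s : seq (nat * nat)) : graph :=
  foldr (fun p g => add_edge g p.1 p.2) ([::], [::]) s.

(** Only an inclusion: a branch of the search knows just some of the edges. *)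
Definition subgraph (g : graph) (R : nat -> nat -> bool) :=
  (forall i j, j \in neighbours g.1 i -> R i j) /\
  (forall i j, i \in neighbours g.2 j -> R i j).

Lemma in_insert i j l i' j' :
  j' \in neighbours (insert i j l) i' ->
  (i' = i /\ j' = j) \/ j' \in neighbours l i'.
Proof.
rewrite /neighbours /insert nth_set_nth /=; case: eqP => [->|_]; last by right.
by rewrite inE => /predU1P[->|]; [left | right].
Qed.

Lemma subgraph_add g R i j : subgraph g R -> R i j -> subgraph (add_edge g i j) R.
Proof.
case=> gR1 gR2 Rij; split=> i' j' /in_insert[[-> ->] //|]; first exact: gR1.
exact: gR2.
Qed.

Lemma subgraph_graph_of s R :
  all (fun p => R p.1 p.2) s -> subgraph (graph_of s) R.
Proof.
elim: s => [_|p s IH /= /andP[Rp /IH]]; last by move/subgraph_add; apply.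
by split=> i j; rewrite /neighbours nth_nil.
Qed.

(** [ua] and [ub] hold the vertices already used on each side, including the ends [a] and [b]
    supplied by the callers; [k] counts the interior vertices on each side. *)
Fixpoint search_path (g : graph) (k a b : nat) (ua ub : seq nat) : bool :=
  if k is k'.+1 then
    hasn (fun b' => if memn b' ub then false else
      hasn (fun a' => if memn a' ua then false else
        search_path g k' a' b (a' :: ua) (b' :: ub)) (neighbours g.2 b'))
      (neighbours g.1 a)
  else memn b (neighbours g.1 a).

Lemma search_pathP g R k a b ua ub :
  subgraph g R -> search_path g k a b ua ub ->
  exists u v, [/\ size u = k, uniq u, uniq v, bipath R a u v b
    & {in u, forall x, x \notin ua} /\ {in v, forall y, y \notin ub}].
Proof.
move=> [gR1 gR2]; elim: k a ua ub => [|k IH] a ua ub /=.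
  by rewrite memnE => /gR1 Rab; exists [::], [::]; split.
case/hasnP=> b' /gR1 Rab'; rewrite memnE; case: ifPn => // b'ub.
case/hasnP=> a' /gR2 Ra'b'; rewrite memnE; case: ifPn => // a'ua.
case/IH=> u [v [sz_u uu uv pth [u_ua v_ub]]].
exists (a' :: u), (b' :: v); split=> /=; rewrite ?sz_u //.
- by rewrite uu andbT; apply/negP=> /u_ua; rewrite mem_head.
- by rewrite uv andbT; apply/negP=> /v_ub; rewrite mem_head.
- by rewrite Rab' Ra'b'.
split=> z; rewrite inE => /predU1P[-> //|].
  by move/u_ua; rewrite inE negb_or => /andP[].
by move/v_ub; rewrite inE negb_or => /andP[].
Qed.

(** [c g i j] says that adding the edge [(i, j)] to [g] completes a forbidden
    configuration. *)
Definition closer : Type := graph -> nat -> nat -> bool.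

Definition closer_sound (R : nat -> nat -> bool) (goal : Prop) (c : closer) :=
  forall g i j, subgraph g R -> R i j -> c g i j -> goal.

Section Search.

Variables (m : nat) (cblue cred : closer).

(** The edge that is found is forced: one of its colors completes a
    configuration. The remaining edges are rotated, so that the next scan starts
    where this one ends. *)
Fixpoint forced (b r : graph) (seen unknown : seq (nat * nat)) :=
  if unknown is (i, j) :: s then
    if (if cred r i j then true else cblue b i j)
    then Some (i, j, s ++ rev seen)
    else forced b r ((i, j) :: seen) s
  else None.

(** The moves are the edges on which to branch when no edge is forced, in the
    order of a depth-first traversal; the unused moves are returned. *)
Fixpoint refute (d : nat) (b r : graph) (unknown moves : seq (nat * nat)) :
    option (seq (nat * nat)) :=
  if d isn't d'.+1 then None else
  let: (i, j, unknown', moves') :=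
    match forced b r [::] unknown, moves with
    | Some (i, j, s), _ => (i, j, s, moves)
    | None, (i, j) :: moves' => (i, j, rem (i, j) unknown, moves')
    | None, [::] => (m, m, [::], [::])
    end in
  if (if i < m then j < m else false) then
    match (if cblue b i j then Some moves'
           else refute d' (add_edge b i j) r unknown' moves') with
    | Some moves'' => if cred r i j then Some moves''
                      else refute d' b (add_edge r i j) unknown' moves''
    | None => None
    end
  else None.

(** Whichever edge of the board is selected, it is blue or red, and each color either completes a
    forbidden configuration or is handed to a recursive call. The selection thus affects only
    whether the search succeeds; the dummy edge [(m, m)] fails the board test. *)
Lemma refuteP (Rb Rr : nat -> nat -> bool) (goal : Prop) d b r unknown moves :
  (forall i j, i < m -> j < m -> Rb i j || Rr i j) ->
  closer_sound Rb goal cblue -> closer_sound Rr goal cred ->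
  subgraph b Rb -> subgraph r Rr ->
  isSome (refute d b r unknown moves) -> goal.
Proof.
move=> total soundb soundr.
elim: d b r unknown moves => [|d IH] b r unknown moves //= bRb rRr.
case: (match forced b r [::] unknown with Some _ => _ | None => _ end).
case=> [[i j] unknown'] moves'.
case: (ltnP i m) => // im; case: (ltnP j m) => // jm.
have [Rbij | Rrij] := orP (total _ _ im jm).
  case: ifPn => [cb _|_]; first exact: soundb bRb Rbij cb.
  case E: refute => [moves''|] // _.
  apply: (IH (add_edge b i j) r unknown' moves') => //; last by rewrite E.
  exact: subgraph_add.
case: (if cblue b i j then _ else _) => // moves''.
case: ifPn => [cr _|_]; first exact: soundr rRr Rrij cr.
by apply: IH => //; apply: subgraph_add.
Qed.

End Search.

(* Bit 4 distinguishes the octal digits from the line breaks. *)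
Definition digit (c : ascii) : option nat :=
  let: Ascii b0 b1 b2 _ b4 _ _ _ := c in
  if b4 then Some (b0 + b1.*2 + b2.*2.*2) else None.

Fixpoint digits (s : string) : seq nat :=
  if s is String c s' then
    if digit c is Some n then n :: digits s' else digits s'
  else [::].

Fixpoint pairs_of (s : seq nat) : seq (nat * nat) :=
  if s is i :: j :: s' then (i, j) :: pairs_of s' else [::].

Definition pairs (s : string) := pairs_of (digits s).

(** The fuel [m * m] is the number of edges of the board, and each level of the search is meant to
    color a new one. *)
Definition refuted (m : nat) (cblue cred : closer) (blue red : seq (nat * nat))
    (moves : string) : bool :=
  let known := blue ++ red in
  let unknown :=
    [seq p <- [seq (i, j) | i <- iota 0 m, j <- iota 0 m] | p \notin known] in
  isSome (refute m cblue cred (m * m) (graph_of blue) (graph_of red) unknown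
            (pairs moves)).

(** * Forbidden configurations and fixed patterns *)

Definition or_closer (c c' : closer) : closer :=
  fun g i j => if c g i j then true else c' g i j.

(** The new edge closes a path of [g] from [i] to [j]. Marking [iota 0 o] as used on both sides
    confines the cycle to the rows and columns from [o] on. *)
Definition cycle_closer (o k : nat) : closer := fun g i j =>
  if o <= i then
    if o <= j then search_path g k.-1 i j (i :: iota 0 o) (j :: iota 0 o)
    else false
  else false.

Definition row_star_closer (o : nat) : closer := fun g i j =>
  let s := [seq j' <- j :: neighbours g.1 i | o <= j'] in
  if o <= i then if 2 < size s then uniq s else false else false.

Definition column_star_closer (o : nat) : closer := fun g i j =>
  let s := [seq i' <- i :: neighbours g.2 j | o <= i'] in
  if o <= j then if 2 < size s then uniq s else false else false.

(* The tests for isolated vertices discard edges that lie on no path from row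
   [0] to column [3]. *)
Definition detour_closer : closer := fun g i j =>
  let isolated l i' := if l is [::] then i' else false in
  if isolated (neighbours g.1 i) (i != 0) then false else
  if isolated (neighbours g.2 j) (j != 3) then false else
  search_path (add_edge g i j) 4 0 3 [:: 0] [:: 3].

Definition shift (o : nat) (pat : seq (nat * nat)) :=
  [seq (o + p.1, o + p.2) | p <- pat].

Definition square := [:: (0, 0); (1, 0); (1, 1); (0, 1)].

Definition hexagon := [:: (0, 0); (1, 0); (1, 1); (2, 1); (2, 2); (0, 2)].

Definition star := [:: (0, 0); (0, 1); (0, 2)].

Definition column_star := [:: (0, 0); (1, 0); (2, 0)].

(** The eight consecutive vertices of the blue cycle: a path that alternates between rows and
    columns, from row [0] to column [3]. *)
Definition window := [:: (0, 0); (1, 0); (1, 1); (2, 1); (2, 2); (3, 2); (3, 3)].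

Definition block (i m j n : nat) :=
  [seq (i', j') | i' <- iota i m, j' <- iota j n].

Definition board4_closer :=
  or_closer (cycle_closer 0 2) (or_closer (row_star_closer 0)
    (or_closer (column_star_closer 0) (cycle_closer 0 3))).

(* The moves in the following lemmas come from a search with lookahead. *)

Lemma refuted_board4 :
  refuted 4 board4_closer (cycle_closer 0 4)
    [::] [::]
    "0001101221211321221330121113221112132212201313101222030321112211210222022113
1302222113301112132112111321112013132023111221110312110313030333111221131112
2111221211122122303121132233133012221321331330132321303121223031303130310111
1222030320102210200222022013130222201331101213201210132010211313212310122010
0312100313030333101220131012201022121012202230201322331330122213203313301323
2030312022303023313031021213202110200321112003032223101120100311100313030333
1011201310112010211110112021302013213313301121132033133013232030312021303023
3130310313102011202122122023201021101112101011202130201221321230112112203212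
3012222030312021303022313031101120223121221220213221222021132213332122212230
3130313031111221203220222120132213332022202230302331303112222013211333202120
2130302331303113232021202130302231303120213022303023312122303130313031".
Proof. by vm_compute. Qed.

Lemma refuted_star5 :
  refuted 5 (cycle_closer 0 2) (cycle_closer 0 4)
    star [::]
    "1020033014414124414014313124043013414123414013313123301340131331313003414014
2121220441401321212240131321214003210421132121032131243141222424042131233141
2223232113142331312324131423313123222431242223312030034140112424120441401123
2312402311131423131423400311041111131423131423031131143141121414041131133141
1213131123241331311314232413313113121431141213313040031104111113142313142303
1121142141121414041121132141121313113334132121131433341321211312142114121321
4003112114213112141404112113213112131311434413212113144344132121131214211412
1321110321321414243224423114222404213213132332234231132223213313312313231314
2213210332144231241214043213423123121331131423132314121214310341121414044112
1313132314121214410312141404121313132314121214031222142432142422322414331413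
24140412221323321323223223133413142313132333431214142212141222".
Proof. by vm_compute. Qed.

(** No moves are listed, since forced edges alone finish the search. *)
Lemma refuted_hexagon5 :
  refuted 5
    (or_closer (cycle_closer 0 2)
      (or_closer (row_star_closer 0) (column_star_closer 0)))
    (cycle_closer 0 4)
    hexagon [::]
    "".
Proof. by vm_compute. Qed.

(** The alternative to a blue $C_6$ is a blue $C_4$ in the board beyond the first square, which
    reduces this case to that of two squares. *)
Lemma refuted_square_star6 :
  refuted 6 (or_closer (cycle_closer 0 3) (cycle_closer 2 2)) (cycle_closer 0 4)
    (square ++ shift 2 star) [::]
    "2031254241055205154241520515213025424205424005152532023240155042301550523015
3335030405124043155005031525150332354050504205505205330543055005050432354050
4205520534054305500505323042050515415131054050420505121342400515052530333435
41501252500515051213333005150512133034051531051245151213142505121305121314".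
Proof. by vm_compute. Qed.

(** The red block joins the rows of the first square to the columns of the second. Blue edges in
    both crossing directions are treated separately. *)
Lemma refuted_squares6 :
  refuted 6 (cycle_closer 0 3) (cycle_closer 0 4)
    (square ++ shift 2 square) (block 0 2 2 2)
    "2004444550055405051540304115253540214142054550501421243442304051144450152130
4051154150213051405134355241503435524243502104444550055405051540314115253540
4205244450501534404050144050254250502434405240500424444550545514344040051415
0515253542344445505405400505142535414244424550500553051525303550545205250515
2530052542141540153040403130311435404243525330142514253135400525455055154044
1424153435403534445050152440405045154250245024425050155030313440142442505215
2534354041434452344230152531152542505024344052402434415042244452544225304041
503042254344455250".
Proof. by vm_compute. Qed.

(** All edges from hexagon rows to square columns are red, and so are those from the first square
    row to the hexagon columns. *)
Lemma refuted_hexagon_square8 :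
  refuted 8 (cycle_closer 0 4) (cycle_closer 0 4)
    (hexagon ++ shift 3 square) (block 0 3 3 2 ++ block 3 1 0 3)
    "0112053550562051525760515617606053166036066007071720273745464754555663606006
0607455056156053600606071617202736605106075565204006206540067540060636500715
1626405050414041254250404115425036465616261540414250072737404117425016072627
4041425016400727414250404142506364654006506041060620063650150760355360070717
2737454647545556636007604635500760601626455117275350605666162640354515601626
5016256026502660401727537040534041425041425060071737402741425063072737404117
4251526060150727404142506040414250073750155152356016263645465455566360475051
5260151625263545531727504142601516252635455353406060545767706364411626351626
3560155456605354566015355051526026273637454647531617545556635354634025414245
5016561640414260252735363717454654556365752535263637274653261736372746533545
5560533545545560273526273526273550176116263536404546476361161725264063405106
0660605155600606061560156006062506606006630716173637412627424647525660601626
6335055006600606405106600606505506606006071560156006062506606006630726273637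
4116174246475152566060162663535463644206526245065565400606350550066006061550
0606606040510660060650531660600660250660601663172627363741060742464751525660
60062663535463644106516145065565400606".
Proof. by vm_compute. Qed.

(** The remaining case: both square rows have a blue edge to the same hexagon column, taken to be
    column [0]. *)
Lemma refuted_hexagon_square8_pinned :
  refuted 8 (cycle_closer 0 4) (cycle_closer 0 4)
    (hexagon ++ shift 3 square ++ [:: (3, 0); (4, 0)]) (block 0 3 3 2)
    "3536515261454653545563265107605361070107121727454754556361075161255556576053
65060706010507121516172627364647545663656606070651615161".
Proof. by vm_compute. Qed.

Lemma refuted_window_star :
  refuted 8 (or_closer detour_closer (cycle_closer 4 2)) (cycle_closer 0 4)
    (window ++ shift 4 star) [::]
    "1442545760353630645007745007550704246047072327600424502351071542203054576070
5257011250516002600770510751010716343542305457607050555706606020610770510742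
5407600405060717012060502440545760050643470737601750254012540760500760600750
0726040540315407605307121720606007500740343536475461071217276151435417506047
1217273037615054500506076020604704505217020441555657645760020405604704050607".
Proof. by vm_compute. Qed.

Lemma refuted_window_hexagon :
  refuted 8
    (or_closer detour_closer (or_closer (cycle_closer 4 2)
      (or_closer (row_star_closer 4) (column_star_closer 4))))
    (cycle_closer 0 4)
    (window ++ shift 4 hexagon) [::]
    "04".
Proof. by vm_compute. Qed.

(** The red block joins the window rows to the columns of the square. *)
Lemma refuted_window_square :
  refuted 8 detour_closer (cycle_closer 0 4)
    (window ++ shift 4 square) (block 0 4 4 2)
    "4153302046364757374243627072020712131760607047375636424362707202061213166060
7036424337627072060713166060706070066023266270076070066036627007607042500131
5647570740607070172027303761607016366070700626616630760760076070607006607007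
6070166070176070124302565737406070700717202761607036066670736061627066017617
0760600717707026617101060717161727617001074060713101404647573761707107172760
6261703071366670766107060707617161703071023020064653475707607070172737616070
6067616263706474757670160707710707563660707016266117607060706676500713765007
0747601617273750606051505136526050512652605051165260475767172737165051526050
5152605051526050515260505152607050165152536046164761626370376070700713172761
6070264757376070700717276160703647570760707017273761607007475360707056613753
6070701727616370172750177027502750606051515260705152606470515253606167505152
5370704751525360646017707074700761076207630771077273500707071607164616610770
0750076170666107702670070774061736374751275253576263707007647050515223265360
6146500761701661077007266007700707646566740617274751525357603761626370607064
7050515236536061461660077007501761706660077026700717742736374751075253576162
6370700764705051065253606140166162710717617060714616600770075017617066600770
2670071774273637475102075253576162637070076471515256616007400661366271076171
4650076170166007700726600770070764656674061727475152535760376162637060706470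
5051365253606140235306617107617143266070072760704650076170266007700716600770
07076465667406273637515253576017616263706070647050511652536061".
Proof. by vm_compute. Qed.

(** Here the square is attached to the window by a blue edge in each direction, through its row [4]
    and its column [4]. Branching is required only when these edges leave both ends of the path,
    column [3] and row [0]. *)
Lemma refuted_window_square_pinned : all (fun p =>
    refuted 8 detour_closer (cycle_closer 0 4)
      (window ++ shift 4 square ++ [:: (4, p.1); (p.2, 4)]) [::]
      (if p == (3, 0) then
"144212464760616270576465666367741761707027376060701666707620
60060717076007061770070617172660706017177070"
       else "")%string)
  [seq (k, l) | k <- iota 0 4, l <- iota 0 4].
Proof. by vm_compute. Qed.

(** * Occurrences of configurations *)

Lemma or_closerP R goal c c' :
  closer_sound R goal c -> closer_sound R goal c' ->
  closer_sound R goal (or_closer c c').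
Proof.
move=> sc sc' g i j gR Rij; rewrite /or_closer.
by case: ifP => [cg _|_ cg]; [apply: sc cg | apply: sc' cg].
Qed.

Lemma closer_sound_imp R (P Q : Prop) c :
  (P -> Q) -> closer_sound R P c -> closer_sound R Q c.
Proof. by move=> PQ sc g i j gR Rij /(sc _ _ _ gR Rij)/PQ. Qed.

Lemma cycle_closerP R o k : 0 < k ->
  closer_sound R (exists a u v b, [/\ (size u).+1 = k, bicycle R a u v b,
    all (leq o) (a :: u) & all (leq o) (rcons v b)]) (cycle_closer o k).
Proof.
case: k => // k _ g i j gR Rij; rewrite /cycle_closer.
case: ifP => // oi; case: ifP => // oj /(search_pathP gR).
case=> u [v [sz_u uu uv pth [u_ua v_ub]]].
have out_iota x y s : x \notin y :: iota 0 s -> x != y /\ s <= x.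
  by rewrite inE negb_or mem_iota add0n -leqNgt => /andP.
exists i, u, v, j; split; rewrite ?sz_u //.
- rewrite /bicycle /= uu uv pth Rij !andbT.
  by apply/andP; split; [apply/negP=> /u_ua | apply/negP=> /v_ub]; rewrite mem_head.
- by rewrite /= oi; apply/allP=> x /u_ua/out_iota[].
- by rewrite all_rcons /= oj; apply/allP=> x /v_ub/out_iota[].
Qed.

Lemma row_star_closerP R o :
  closer_sound R (exists i s, [/\ o <= i, 2 < size s, uniq s, all (leq o) s
    & {in s, forall j, R i j}]) (row_star_closer o).
Proof.
move=> g i j [gR _] Rij; rewrite /row_star_closer.
case: ifP => // oi; case: ifP => // sz us; exists i; eexists; split; eauto.
  exact: filter_all.
by move=> j'; rewrite mem_filter inE => /andP[_ /predU1P[->|/gR]].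
Qed.

Lemma column_star_closerP R o :
  closer_sound R (exists j s, [/\ o <= j, 2 < size s, uniq s, all (leq o) s
    & {in s, forall i, R i j}]) (column_star_closer o).
Proof.
move=> g i j [_ gR] Rij; rewrite /column_star_closer.
case: ifP => // oj; case: ifP => // sz us; exists j; eexists; split; eauto.
  exact: filter_all.
by move=> i'; rewrite mem_filter inE => /andP[_ /predU1P[->|/gR]].
Qed.

Lemma detour_closerP R :
  closer_sound R (exists u v, [/\ size u = 4, uniq (0 :: u), uniq (3 :: v)
    & bipath R 0 u v 3]) detour_closer.
Proof.
move=> g i j gR Rij; rewrite /detour_closer; do 2![case: ifP => // _].
case/(search_pathP (subgraph_add gR Rij))=> u [v [sz_u uu uv pth [u_ua v_ub]]].
exists u, v; split=> //=.
  by rewrite uu andbT; apply/negP=> /u_ua; rewrite mem_head.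
by rewrite uv andbT; apply/negP=> /v_ub; rewrite mem_head.
Qed.

Section Boards.

Variables (A B : eqType) (a0 : A) (b0 : B).
Implicit Types (r : A -> B -> bool) (f X : seq A) (g Y : seq B).

(** The lists [f] and [g] number the vertices, so that computations on [nat] apply to any types; the
    bounds keep the default values [a0] and [b0] out. *)
Definition on_board r f g : nat -> nat -> bool :=
  fun i j => [&& i < size f, j < size g & r (nth a0 f i) (nth b0 g j)].

Definition holds r f g (pat : seq (nat * nat)) :=
  all (fun p => on_board r f g p.1 p.2) pat.

(** The whole of [X] and [Y] is reordered, so that the vertices outside the pattern stay available
    for later steps. *)
Definition occurs r (pat : seq (nat * nat)) X Y :=
  exists X' Y', [/\ perm_eq X' X, perm_eq Y' Y & holds r X' Y' pat].

Lemma nth_uniq_map f l : uniq f -> uniq l -> all (fun i => i < size f) l ->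
  uniq (map (nth a0 f) l).
Proof.
move=> uf ul /allP lf; rewrite map_inj_in_uniq // => i j /lf iX /lf jX /eqP.
by rewrite nth_uniq // => /eqP.
Qed.

Lemma reorder X l : uniq X -> uniq l -> {subset l <= X} ->
  exists X', perm_eq (l ++ X') X.
Proof.
move=> uX ul lX; exists [seq x <- X | x \notin l]; apply: uniq_perm => //.
  rewrite cat_uniq ul filter_uniq // andbT; apply/hasPn=> x.
  by rewrite mem_filter => /andP[].
move=> x; rewrite mem_cat mem_filter; case: (boolP (x \in l)) => //= /lX ->.
by [].
Qed.

End Boards.

(** The vertices at the positions [l] and [l'] are moved to the front. They avoid the prefixes [S]
    and [T], which hold a configuration placed earlier. *)
Lemma occurs_indices (A B : eqType) (a0 : A) (b0 : B) r S X T Y l l' pat :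
  uniq X -> uniq Y -> uniq l -> uniq l' ->
  all (fun i => size S <= i < size (S ++ X)) l ->
  all (fun j => size T <= j < size (T ++ Y)) l' ->
  all (fun p => [&& p.1 < size l, p.2 < size l'
     & on_board a0 b0 r (S ++ X) (T ++ Y) (nth 0 l p.1) (nth 0 l' p.2)]) pat ->
  occurs a0 b0 r pat X Y.
Proof.
have sub (C : eqType) (c0 : C) (S' X' : seq C) s :
    uniq X' -> uniq s -> all (fun i => size S' <= i < size (S' ++ X')) s ->
    exists X1, perm_eq ([seq nth c0 (S' ++ X') i | i <- s] ++ X1) X'.
  move=> uX' us /allP sX.
  have nthX i : i \in s -> [/\ size S' <= i, i - size S' < size X'
      & nth c0 (S' ++ X') i = nth c0 X' (i - size S')].
    case/sX/andP=> Si; rewrite size_cat -ltn_subLR // => iX; split=> //.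
    by rewrite nth_cat ltnNge Si.
  apply: reorder => //; last by move=> x /mapP[i /nthX[_ iX ->] ->]; apply: mem_nth.
  rewrite map_inj_in_uniq // => i j /nthX[Si iX ->] /nthX[Sj jX ->] /eqP.
  by rewrite nth_uniq // => /eqP eq_ij; rewrite -(subnK Si) -(subnK Sj) eq_ij.
move=> uX uY ul ul' lX lY /allP H.
have [X1 pX] := sub _ a0 S X l uX ul lX.
have [Y1 pY] := sub _ b0 T Y l' uY ul' lY.
do 2!eexists; split; eauto; apply/allP=> p /H/and3P[pl pl' /and3P[_ _ rp]].
rewrite /on_board !size_cat !size_map !nth_cat !size_map pl pl' !ltn_addr //.
by rewrite !(nth_map 0).
Qed.

Section Occurrences.

Variables (A B : eqType) (a0 : A) (b0 : B).
Implicit Types (r : A -> B -> bool) (f S X : seq A) (g T Y : seq B).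

Local Notation on_board := (on_board a0 b0).
Local Notation holds := (holds a0 b0).
Local Notation occurs := (occurs a0 b0).

Lemma bipath_on_board r f g a u v b :
  uniq f -> uniq g -> uniq (a :: u) -> uniq (b :: v) ->
  bipath (on_board r f g) a u v b ->
  let F := nth a0 f in let G := nth b0 g in
  [/\ uniq (F a :: map F u), uniq (G b :: map G v),
      bipath r (F a) (map F u) (map G v) (G b),
      {subset map F u <= f} & {subset map G v <= g}].
Proof.
move=> uf ug uau ubv pth F G; have [domA domB] := bipath_dom pth.
have auf x : x \in a :: u -> x < size f by case/domA=> y /andP[].
have bvg y : y \in b :: v -> y < size g by case/domB=> x /and3P[].
rewrite -!map_cons /F /G !nth_uniq_map //; try exact/allP.
split=> //; first by apply: bipath_map pth => x y /and3P[].
- move=> _ /mapP[x xu ->]; apply/mem_nth/auf; by rewrite inE xu orbT.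
- move=> _ /mapP[x xu ->]; apply/mem_nth/bvg; by rewrite inE xu orbT.
Qed.

Lemma has_bicycle_on_board r f g k : uniq f -> uniq g ->
  has_bicycle (on_board r f g) k -> has_bicycle r k.
Proof.
move=> uf ug [a [u [v [b [sz_u /and4P[ua ub pth /and3P[_ _ rab]]]]]]].
have [uF uG pthFG _ _] := bipath_on_board uf ug ua ub pth.
exists (nth a0 f a), (map (nth a0 f) u), (map (nth b0 g) v), (nth b0 g b).
by rewrite size_map sz_u /bicycle uF uG pthFG.
Qed.

Lemma cycle_closer_on_board r f g k : 0 < k -> uniq f -> uniq g ->
  closer_sound (on_board r f g) (has_bicycle r k) (cycle_closer 0 k).
Proof.
move=> k_gt0 uf ug; apply: closer_sound_imp (@cycle_closerP _ 0 k k_gt0).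
case=> a [u [v [b [sz_u cyc _ _]]]]; apply: has_bicycle_on_board uf ug _.
by exists a, u, v, b.
Qed.

Lemma on_boardW r f g i j o : o <= i -> on_board r f g i j -> o <= i < size f.
Proof. by move=> -> /andP[]. Qed.

Lemma on_boardWr r f g i j o : o <= j -> on_board r f g i j -> o <= j < size g.
Proof. by move=> -> /and3P[]. Qed.

Lemma square_closer_occurs r S X T Y : uniq X -> uniq Y -> size S = size T ->
  closer_sound (on_board r (S ++ X) (T ++ Y)) (occurs r square X Y)
    (cycle_closer (size S) 2).
Proof.
move=> uX uY eq_ST; apply: closer_sound_imp (@cycle_closerP _ (size S) 2 isT).
case=> a [u [v [b [sz_u]]]]; case: u sz_u => [|a' [|? ?]] //= _.
case/and4P=> ua; case: v => [|b' [|? ?]] //=; last by rewrite !andbF.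
move=> ub /and3P[rab' ra'b' ra'b] rab /and3P[oa oa' _] /and3P[ob' ob _].
rewrite eq_ST in ob' ob.
apply: (@occurs_indices _ _ _ _ r S X T Y [:: a; a'] [:: b'; b]) => //.
- by rewrite /= andbT; move: ub; rewrite !inE andbT eq_sym.
- by rewrite /= (on_boardW oa rab) (on_boardW oa' ra'b).
- by rewrite /= (on_boardWr ob rab) (on_boardWr ob' rab').
- by rewrite /= rab rab' ra'b ra'b'.
Qed.

Lemma hexagon_closer_occurs r S X T Y : uniq X -> uniq Y -> size S = size T ->
  closer_sound (on_board r (S ++ X) (T ++ Y)) (occurs r hexagon X Y)
    (cycle_closer (size S) 3).
Proof.
move=> uX uY eq_ST; apply: closer_sound_imp (@cycle_closerP _ (size S) 3 isT).
case=> a [u [v [b [sz_u]]]]; case: u sz_u => [|a' [|a'' [|? ?]]] //= _.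
case/and4P=> ua; case: v => [|b' [|b'' [|? ?]]] //=; rewrite ?andbF //.
move=> ub /and5P[rab' ra'b' ra'b'' ra''b'' ra''b] rab /and4P[oa oa' oa'' _].
case/and4P=> ob' ob'' ob _; rewrite eq_ST in ob' ob'' ob.
apply: (@occurs_indices _ _ _ _ r S X T Y [:: a; a'; a''] [:: b'; b''; b]) => //.
- by rewrite (rcons_uniq [:: b'; b'']).
- by rewrite /= (on_boardW oa rab) (on_boardW oa' ra'b') (on_boardW oa'' ra''b).
- by rewrite /= (on_boardWr ob rab) (on_boardWr ob' rab') (on_boardWr ob'' ra'b'').
- by rewrite /= rab rab' ra'b' ra'b'' ra''b ra''b''.
Qed.

Lemma star_closer_occurs r S X T Y : uniq X -> uniq Y -> size S = size T ->
  closer_sound (on_board r (S ++ X) (T ++ Y)) (occurs r star X Y)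
    (row_star_closer (size S)).
Proof.
move=> uX uY eq_ST; apply: closer_sound_imp (@row_star_closerP _ (size S)).
case=> i [[|j1 [|j2 [|j3 s]]]] [oi] // _.
rewrite -[[:: j1, j2, j3 & s]]/([:: j1; j2; j3] ++ s) cat_uniq all_cat.
case/and3P=> us _ _ /andP[/= /and4P[o1 o2 o3 _] _] ris.
have [r1 r2 r3] : [/\ on_board r (S ++ X) (T ++ Y) i j1,
    on_board r (S ++ X) (T ++ Y) i j2 & on_board r (S ++ X) (T ++ Y) i j3].
  by split; apply: ris; rewrite !inE eqxx ?orbT.
rewrite eq_ST in o1 o2 o3.
apply: (@occurs_indices _ _ _ _ r S X T Y [:: i] [:: j1; j2; j3]) => //.
- by rewrite /= (on_boardW oi r1).
- by rewrite /= (on_boardWr o1 r1) (on_boardWr o2 r2) (on_boardWr o3 r3).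
- by rewrite /= r1 r2 r3.
Qed.

Lemma column_star_closer_occurs r S X T Y : uniq X -> uniq Y -> size S = size T ->
  closer_sound (on_board r (S ++ X) (T ++ Y)) (occurs r column_star X Y)
    (column_star_closer (size S)).
Proof.
move=> uX uY eq_ST; apply: closer_sound_imp (@column_star_closerP _ (size S)).
case=> j [[|i1 [|i2 [|i3 s]]]] [oj] // _.
rewrite -[[:: i1, i2, i3 & s]]/([:: i1; i2; i3] ++ s) cat_uniq all_cat.
case/and3P=> us _ _ /andP[/= /and4P[o1 o2 o3 _] _] ris.
have [r1 r2 r3] : [/\ on_board r (S ++ X) (T ++ Y) i1 j,
    on_board r (S ++ X) (T ++ Y) i2 j & on_board r (S ++ X) (T ++ Y) i3 j].
  by split; apply: ris; rewrite !inE eqxx ?orbT.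
rewrite eq_ST in oj.
apply: (@occurs_indices _ _ _ _ r S X T Y [:: i1; i2; i3] [:: j]) => //.
- by rewrite /= (on_boardW o1 r1) (on_boardW o2 r2) (on_boardW o3 r3).
- by rewrite /= (on_boardWr oj r1).
- by rewrite /= r1 r2 r3.
Qed.

Lemma occurs_perm r pat X Y X' Y' : perm_eq X X' -> perm_eq Y Y' ->
  occurs r pat X Y -> occurs r pat X' Y'.
Proof.
move=> pX pY [X1 [Y1 [p1 p2 h]]]; exists X1, Y1.
by split=> //; [apply: perm_trans pX | apply: perm_trans pY].
Qed.

Lemma holds_cat r pat X Y X1 Y1 : holds r X Y pat -> holds r (X ++ X1) (Y ++ Y1) pat.
Proof.
apply: sub_all => p /and3P[pX pY rp]; rewrite /on_board !size_cat !nth_cat.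
by rewrite pX pY !ltn_addr.
Qed.

Lemma occurs_cat r pat X Y X1 Y1 :
  occurs r pat X Y -> occurs r pat (X ++ X1) (Y ++ Y1).
Proof.
case=> X' [Y' [pX pY h]]; exists (X' ++ X1), (Y' ++ Y1).
by rewrite !perm_cat2r; split=> //; apply: holds_cat.
Qed.

Lemma occurs_catl r pat X Y X1 Y1 :
  occurs r pat X Y -> occurs r pat (X1 ++ X) (Y1 ++ Y).
Proof.
by move=> /(occurs_cat X1 Y1); apply: occurs_perm; rewrite perm_catC.
Qed.

(** The passage from a computed refutation to actual vertices: every pair on the board is red or
    blue, which is the totality required by [refuteP]. *)
Lemma refuted_goal r f g m cblue blue red moves (goal : Prop) :
  refuted m cblue (cycle_closer 0 4) blue red moves ->
  size f = m -> size g = m -> uniq f -> uniq g ->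
  holds (non r) f g blue -> holds r f g red ->
  closer_sound (on_board (non r) f g) goal cblue ->
  has_bicycle r 4 \/ goal.
Proof.
move=> refd sz_f sz_g uf ug hb hr scb.
apply: (@refuteP m cblue (cycle_closer 0 4) (on_board (non r) f g)
  (on_board r f g) _ _ _ _ _ _ _ _ _ (subgraph_graph_of hb)
  (subgraph_graph_of hr) refd).
- by move=> i j im jm; rewrite /on_board /non sz_f sz_g im jm /= orNb.
- by apply: closer_sound_imp scb; right.
- by apply: closer_sound_imp (cycle_closer_on_board _ uf ug); first left.
Qed.

End Occurrences.

Lemma occurs_flip (A B : eqType) (a0 : A) (b0 : B) r pat X Y :
  occurs b0 a0 (flip2 r) [seq (p.2, p.1) | p <- pat] Y X -> occurs a0 b0 r pat X Y.
Proof.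
case=> Y' [X' [pY pX]]; rewrite /holds all_map => h; exists X', Y'; split=> //.
by apply: sub_all h => p /and3P[p2 p1 rp]; apply/and3P.
Qed.

(** * Boards of sizes four, five, six and eight *)

Section SmallBoards.

Variables (A B : eqType) (a0 : A) (b0 : B).
Implicit Types (r : A -> B -> bool) (f S X : seq A) (g T Y : seq B).

Local Notation on_board := (on_board a0 b0).
Local Notation holds := (holds a0 b0).
Local Notation occurs := (occurs a0 b0).

Lemma holds_pat_cat r f g pat pat' :
  holds r f g (pat ++ pat') = holds r f g pat && holds r f g pat'.
Proof. exact: all_cat. Qed.

Lemma holds_shift r S T X Y o pat : size S = o -> size T = o ->
  holds r X Y pat -> holds r (S ++ X) (T ++ Y) (shift o pat).
Proof.
move=> sS sT; rewrite /holds all_map; apply: sub_all => p /and3P[p1 p2 rp].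
rewrite /on_board /= !size_cat !nth_cat sS sT !ltn_add2l p1 p2.
by rewrite !ltnNge !leq_addr !addKn.
Qed.

Definition in_board (m : nat) (pat : seq (nat * nat)) :=
  all (fun p => (p.1 < m) && (p.2 < m)) pat.

Lemma holdsPn r f g m pat : size f = m -> size g = m -> in_board m pat ->
  holds r f g pat \/ exists2 p, p \in pat & on_board (non r) f g p.1 p.2.
Proof.
move=> sf sg /allP inb; case: (boolP (holds r f g pat)); first by left.
case/allPn=> p p_pat np; right; exists p => //; case/andP: (inb _ p_pat) => p1 p2.
by move: np; rewrite /on_board sf sg p1 p2.
Qed.

(** Symmetries of patterns are checked by computation in this form. *)
Definition reindexes (l l' : seq nat) (pat pat' : seq (nat * nat)) :=
  all (fun p => [&& p.1 < size l, p.2 < size l'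
                  & (nth 0 l p.1, nth 0 l' p.2) \in pat]) pat'.

Lemma holds_reindex r f g l l' pat pat' : reindexes l l' pat pat' ->
  holds r f g pat -> holds r (map (nth a0 f) l) (map (nth b0 g) l') pat'.
Proof.
move=> /allP re /allP h; apply/allP=> p /re/and3P[pl pl' /h/and3P[/= _ _ rp]].
by rewrite /on_board !size_map pl pl' !(nth_map 0).
Qed.

Lemma perm_reindex (C : eqType) (c0 : C) (s : seq C) l m :
  size s = m -> perm_eq l (iota 0 m) -> perm_eq (map (nth c0 s) l) s.
Proof.
move=> sz_s /(perm_map (nth c0 s)) pl; apply: perm_trans pl _.
by rewrite -sz_s -/(mkseq _ _) mkseq_nth.
Qed.

Lemma board4_occurs r X Y : size X = 4 -> size Y = 4 -> uniq X -> uniq Y ->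
  has_bicycle r 4 \/
  [\/ occurs (non r) square X Y, occurs (non r) star X Y,
      occurs (non r) column_star X Y | occurs (non r) hexagon X Y].
Proof.
move=> sX sY uX uY.
apply: (@refuted_goal _ _ a0 b0 _ _ _ _ _ _ _ _ _ refuted_board4
  sX sY uX uY isT isT).
apply: or_closerP.
  apply: closer_sound_imp (@square_closer_occurs _ _ a0 b0 _ [::] X [::] Y uX uY erefl).
  exact: Or41.
apply: or_closerP.
  apply: closer_sound_imp (@star_closer_occurs _ _ a0 b0 _ [::] X [::] Y uX uY erefl).
  exact: Or42.
apply: or_closerP.
  apply: closer_sound_imp (@column_star_closer_occurs _ _ a0 b0 _ [::] X [::] Y uX uY erefl).
  exact: Or43.
apply: closer_sound_imp (@hexagon_closer_occurs _ _ a0 b0 _ [::] X [::] Y uX uY erefl).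
exact: Or44.
Qed.

Lemma star5_square r X Y : size X = 5 -> size Y = 5 -> uniq X -> uniq Y ->
  occurs (non r) star X Y -> has_bicycle r 4 \/ occurs (non r) square X Y.
Proof.
move=> sX sY uX uY [X' [Y' [pX pY h]]].
have [uX' uY'] : uniq X' /\ uniq Y' by rewrite (perm_uniq pX) (perm_uniq pY).
rewrite -(perm_size pX) in sX; rewrite -(perm_size pY) in sY.
case: (refuted_goal refuted_star5 sX sY uX' uY' h isT
  (@square_closer_occurs _ _ a0 b0 _ [::] X' [::] Y' uX' uY' erefl)); first by left.
by move/(occurs_perm pX pY); right.
Qed.

End SmallBoards.

Lemma column_star_flip (A B : eqType) (a0 : A) (b0 : B) r X Y :
  occurs a0 b0 (non r) column_star X Y -> occurs b0 a0 (non (flip2 r)) star Y X.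
Proof. by move=> ?; apply: occurs_flip. Qed.

Lemma square_flip (A B : eqType) (a0 : A) (b0 : B) r X Y :
  uniq X -> uniq Y ->
  occurs a0 b0 (non r) square X Y -> occurs b0 a0 (non (flip2 r)) square Y X.
Proof.
move=> uX uY [X' [Y' [pX pY /and5P[h0 h1 h2 h3 _]]]].
by apply: occurs_flip; exists X', Y'; split; rewrite /holds /= ?h0 ?h1 ?h2 ?h3.
Qed.

(** A $K_{4,4}$ inside the board supplies a blue square, star or hexagon. A star leads to a square
    by [star5_square], on the transposed board for a column star, and a hexagon leads to one of the
    other cases. *)
Lemma board5_square (A B : eqType) (a0 : A) (b0 : B) r X Y :
  size X = 5 -> size Y = 5 -> uniq X -> uniq Y ->
  has_bicycle r 4 \/ occurs a0 b0 (non r) square X Y.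
Proof.
move=> sX sY uX uY.
have star_case := star5_square (r := r) sX sY uX uY.
have column_case : occurs a0 b0 (non r) column_star X Y ->
    has_bicycle r 4 \/ occurs a0 b0 (non r) square X Y.
  move/column_star_flip/(star5_square sY sX uY uX).
  by case=> [/has_bicycle_flip|/(square_flip uY uX)]; [left | right].
have := @board4_occurs _ _ a0 b0 r (take 4 X) (take 4 Y).
rewrite !size_takel ?sX ?sY // !take_uniq // => /(_ erefl erefl isT isT).
have up pat : occurs a0 b0 (non r) pat (take 4 X) (take 4 Y) ->
    occurs a0 b0 (non r) pat X Y.
  by move/(occurs_cat (drop 4 X) (drop 4 Y)); rewrite !cat_take_drop.
case=> [|[/up|/up|/up|/up]].
- by left.
- by right.
- exact: star_case.
- exact: column_case.
case=> X' [Y' [pX pY h]].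
have [uX' uY'] : uniq X' /\ uniq Y' by rewrite (perm_uniq pX) (perm_uniq pY).
have sX' : size X' = 5 by rewrite (perm_size pX).
have sY' : size Y' = 5 by rewrite (perm_size pY).
have [||] := refuted_goal (goal := [\/ occurs a0 b0 (non r) square X Y,
    occurs a0 b0 (non r) star X Y | occurs a0 b0 (non r) column_star X Y])
  refuted_hexagon5 sX' sY' uX' uY' h isT; last 2 first.
- by left.
- by case=> [|/star_case|/column_case] //; right.
apply: or_closerP; last apply: or_closerP.
- apply: closer_sound_imp (@square_closer_occurs _ _ a0 b0 _ [::] X' [::] Y' uX' uY' erefl).
  by move/(occurs_perm pX pY); apply: Or31.
- apply: closer_sound_imp (@star_closer_occurs _ _ a0 b0 _ [::] X' [::] Y' uX' uY' erefl).
  by move/(occurs_perm pX pY); apply: Or32.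
- apply: closer_sound_imp (@column_star_closer_occurs _ _ a0 b0 _ [::] X' [::] Y' uX' uY' erefl).
  by move/(occurs_perm pX pY); apply: Or33.
Qed.

Definition transpose (pat : seq (nat * nat)) := [seq (p.2, p.1) | p <- pat].

Lemma holds_sub (A B : eqType) (a0 : A) (b0 : B) r f g pat pat' :
  all (fun p => p \in pat) pat' -> holds a0 b0 r f g pat -> holds a0 b0 r f g pat'.
Proof. by move=> /allP sub /allP h; apply/allP=> p /sub/h. Qed.

Lemma holds_flip (A B : eqType) (a0 : A) (b0 : B) r f g pat :
  holds a0 b0 r f g pat -> holds b0 a0 (flip2 r) g f (transpose pat).
Proof.
rewrite /holds all_map; apply: sub_all => p /and3P[p1 p2 rp].
by rewrite /on_board /= p1 p2.
Qed.

(** Transposing the hexagon changes its edge list; a cyclic shift of three vertices on one side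
    restores it. *)
Lemma hexagon_flip (A B : eqType) (a0 : A) (b0 : B) r X Y :
  uniq X -> uniq Y ->
  occurs a0 b0 (non r) hexagon X Y -> occurs b0 a0 (non (flip2 r)) hexagon Y X.
Proof.
move=> uX uY [X' [Y' [pX pY h]]]; apply: occurs_flip.
apply: (occurs_perm pX pY).
have [uX' uY'] : uniq X' /\ uniq Y' by rewrite (perm_uniq pX) (perm_uniq pY).
case/and5P: h => h0 h1 h2 h3 /and3P[h4 h5 _].
apply: (@occurs_indices _ _ a0 b0 _ [::] X' [::] Y' [:: 1; 2; 0] [:: 0; 1; 2]) => //=.
- by rewrite -/(size X'); case/andP: h0 => ->; case/andP: h1 => ->; case/andP: h3 => ->.
- by case/and3P: h0 => _ -> _; case/and3P: h2 => _ -> _; case/and3P: h4 => _ ->.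
- by rewrite /flip2 /= h0 h1 h2 h3 h4 h5.
Qed.

(** The first pattern stays within the first [o] rows and columns, so reordering the others to
    exhibit the second pattern does not disturb it. *)
Lemma assemble (A B : eqType) (a0 : A) (b0 : B) r X Y o pat pat' :
  o <= size X -> o <= size Y -> in_board o pat -> holds a0 b0 r X Y pat ->
  occurs a0 b0 r pat' (drop o X) (drop o Y) ->
  exists X1 Y1, [/\ perm_eq X1 (drop o X), perm_eq Y1 (drop o Y) &
    holds a0 b0 r (take o X ++ X1) (take o Y ++ Y1) (pat ++ shift o pat')].
Proof.
move=> oX oY /allP inb /allP h [X1 [Y1 [pX pY h']]]; exists X1, Y1; split=> //.
rewrite holds_pat_cat holds_shift ?size_takel // andbT; apply/allP=> p p_pat.
case/andP: (inb _ p_pat) => p1 p2; case/and3P: (h _ p_pat) => _ _ rp.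
rewrite /on_board !size_cat !nth_cat !size_takel // p1 p2 !nth_take //.
by rewrite !ltn_addr.
Qed.

Lemma perm_take_drop (C : eqType) o (s s1 : seq C) :
  perm_eq s1 (drop o s) -> perm_eq (take o s ++ s1) s.
Proof. by move=> ps; rewrite -[X in perm_eq _ X](cat_take_drop o) perm_cat2l. Qed.

(** Two blue edges that cross in opposite directions join the squares into a $C_6$: one square is
    traversed along three edges and the other along one. *)
Lemma crossing6 : all (fun p => all (fun q =>
    cycle_closer 0 3 (graph_of ((square ++ shift 2 square) ++ [:: p; q])) p.1 p.2)
  (block 2 2 0 2)) (block 0 2 2 2).
Proof. by vm_compute. Qed.

(** Either all edges in one crossing direction are red, and the refutation applies to the board or
    its transpose, or [crossing6] applies. *)
Lemma board6_squares (A B : eqType) (a0 : A) (b0 : B) r f g :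
  size f = 6 -> size g = 6 -> uniq f -> uniq g ->
  holds a0 b0 (non r) f g (square ++ shift 2 square) ->
  has_bicycle r 4 \/ occurs a0 b0 (non r) hexagon f g.
Proof.
move=> sf sg uf ug h.
have [red|[p p_in bp]] := @holdsPn _ _ a0 b0 r f g 6 (block 0 2 2 2) sf sg isT.
  exact: (refuted_goal refuted_squares6 sf sg uf ug h red
    (@hexagon_closer_occurs _ _ a0 b0 _ [::] f [::] g uf ug erefl)).
have [red|[q q_in bq]] := @holdsPn _ _ a0 b0 r f g 6 (block 2 2 0 2) sf sg isT.
  have h' : holds b0 a0 (non (flip2 r)) g f (square ++ shift 2 square).
    exact: holds_sub (holds_flip h).
  have red' : holds b0 a0 (flip2 r) g f (block 0 2 2 2).
    exact: holds_sub (holds_flip red).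
  have := refuted_goal refuted_squares6 sg sf ug uf h' red'
    (@hexagon_closer_occurs _ _ b0 a0 _ [::] g [::] f ug uf erefl).
  by case=> [/has_bicycle_flip|/(hexagon_flip ug uf)]; [left | right].
right; apply: (@hexagon_closer_occurs _ _ a0 b0 _ [::] f [::] g uf ug erefl
  _ _ _ _ bp (allP (allP crossing6 _ p_in) _ q_in)).
by apply: subgraph_graph_of; rewrite all_cat -/(holds _ _ _ _ _ _) h /= bp bq.
Qed.

Lemma board6_star (A B : eqType) (a0 : A) (b0 : B) r X Y :
  size X = 6 -> size Y = 6 -> uniq X -> uniq Y ->
  holds a0 b0 (non r) X Y square ->
  occurs a0 b0 (non r) star (drop 2 X) (drop 2 Y) ->
  [\/ has_bicycle r 4, occurs a0 b0 (non r) hexagon X Y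
    | occurs a0 b0 (non r) square (drop 2 X) (drop 2 Y)].
Proof.
move=> sX sY uX uY h star_XY.
have [|||X1 [Y1 [pX pY h1]]] := assemble _ _ _ h star_XY; rewrite ?sX ?sY //.
have qX := perm_take_drop pX; have qY := perm_take_drop pY.
have [uf ug] : uniq (take 2 X ++ X1) /\ uniq (take 2 Y ++ Y1).
  by rewrite (perm_uniq qX) (perm_uniq qY).
have [uX1 uY1] : uniq X1 /\ uniq Y1.
  by rewrite (perm_uniq pX) (perm_uniq pY) !drop_uniq.
have [|||bic|[hex|sq]] := refuted_goal
  (goal := occurs a0 b0 (non r) hexagon X Y \/
           occurs a0 b0 (non r) square (drop 2 X) (drop 2 Y))
  refuted_square_star6 _ _ uf ug h1 isT.
- by rewrite (perm_size qX).
- by rewrite (perm_size qY).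
- apply: or_closerP.
    apply: closer_sound_imp
      (@hexagon_closer_occurs _ _ a0 b0 _ [::] _ [::] _ uf ug erefl).
    by move/(occurs_perm qX qY); left.
  have sz2 : size (take 2 X) = 2 by rewrite size_takel ?sX.
  rewrite -[X in cycle_closer X]sz2.
  apply: closer_sound_imp (@square_closer_occurs _ _ a0 b0 _ _ _ _ _ uX1 uY1 _).
    by move/(occurs_perm pX pY); right.
  by rewrite !size_takel ?sX ?sY.
- exact: Or31.
- exact: Or32.
- exact: Or33.
Qed.

(** Beside a blue square found in a $K_{5,5}$ there remains a $K_{4,4}$. It contains a hexagon
    outright, a square, or a star that leads to a square or a hexagon. *)
Lemma board6_hexagon (A B : eqType) (a0 : A) (b0 : B) r X Y :
  size X = 6 -> size Y = 6 -> uniq X -> uniq Y ->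
  has_bicycle r 4 \/ occurs a0 b0 (non r) hexagon X Y.
Proof.
move=> sX sY uX uY.
have := @board5_square _ _ a0 b0 r (take 5 X) (take 5 Y).
rewrite !size_takel ?sX ?sY // !take_uniq // => /(_ erefl erefl isT isT).
case=> [|/(occurs_cat (drop 5 X) (drop 5 Y))]; first by left.
rewrite !cat_take_drop => -[X' [Y' [pX pY h]]].
suff [|/(occurs_perm pX pY)]: has_bicycle r 4 \/ occurs a0 b0 (non r) hexagon X' Y'.
- by left.
- by right.
have [uX' uY'] : uniq X' /\ uniq Y' by rewrite (perm_uniq pX) (perm_uniq pY).
rewrite -(perm_size pX) in sX; rewrite -(perm_size pY) in sY.
have [uX4 uY4] : uniq (drop 2 X') /\ uniq (drop 2 Y') by rewrite !drop_uniq.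
have square_case : occurs a0 b0 (non r) square (drop 2 X') (drop 2 Y') ->
    has_bicycle r 4 \/ occurs a0 b0 (non r) hexagon X' Y'.
  move=> sq.
  have [|||X1 [Y1 [pX1 pY1 h1]]] := assemble _ _ _ h sq; rewrite ?sX ?sY //.
  have qX := perm_take_drop pX1; have qY := perm_take_drop pY1.
  have [||||bic|hex] := board6_squares _ _ _ _ h1.
  - by rewrite (perm_size qX).
  - by rewrite (perm_size qY).
  - by rewrite (perm_uniq qX).
  - by rewrite (perm_uniq qY).
  - by left.
  - by right; apply: occurs_perm hex.
have [||||bic|[sq|st|st|hex]] := @board4_occurs _ _ a0 b0 r (drop 2 X') (drop 2 Y').
- by rewrite size_drop sX.
- by rewrite size_drop sY.
- by [].
- by [].
- by left.
- exact: square_case.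
- case: (board6_star sX sY uX' uY' h st) => [||/square_case //]; by [left | right].
- have h' : holds b0 a0 (non (flip2 r)) Y' X' square.
    exact: holds_sub (holds_flip h).
  case: (board6_star sY sX uY' uX' h' (column_star_flip st)).
  + by move/has_bicycle_flip; left.
  + by move/(hexagon_flip uY' uX'); right.
  + by move/(square_flip uY4 uX4)/square_case.
- right; rewrite -(cat_take_drop 2 X') -(cat_take_drop 2 Y'); exact: occurs_catl.
Qed.

(** The ends of the crossing edges are joined inside the hexagon by a path of length 5 and inside
    the square by one of length 1, or by two paths of length 3. *)
Lemma crossing8 : all (fun p => all (fun q =>
    cycle_closer 0 4 (graph_of ((hexagon ++ shift 3 square) ++ [:: p; q])) p.1 p.2)
  (block 3 2 0 3)) (block 0 3 3 2).
Proof. by vm_compute. Qed.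

(** Edges from the two square rows to distinct hexagon columns give a $C_8$ with a path of length 4
    in the hexagon and one of length 2 in the square. *)
Lemma diagonal8 : all (fun p => all (fun q => (p.2 == q.2) ||
    cycle_closer 0 4 (graph_of ((hexagon ++ shift 3 square) ++ [:: p; q])) p.1 p.2)
  (block 4 1 0 3)) (block 3 1 0 3).
Proof. by vm_compute. Qed.

Definition rotation (k : nat) := rot k (iota 0 3) ++ iota 3 5.

(** A simultaneous cyclic shift of its rows and columns is an automorphism of the hexagon; it brings
    column [k] to position [0] and preserves the red block. *)
Lemma rotation_reindexes : all (fun k => [&& perm_eq (rotation k) (iota 0 8),
    reindexes (rotation k) (rotation k)
      ((hexagon ++ shift 3 square) ++ [:: (3, k); (4, k)])
      (hexagon ++ shift 3 square ++ [:: (3, 0); (4, 0)])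
  & reindexes (rotation k) (rotation k) (block 0 3 3 2) (block 0 3 3 2)])
  (iota 0 3).
Proof. by vm_compute. Qed.

Lemma reindex_board (C : eqType) (c0 : C) (s : seq C) l m :
  size s = m -> uniq s -> perm_eq l (iota 0 m) ->
  size (map (nth c0 s) l) = m /\ uniq (map (nth c0 s) l).
Proof.
move=> sz_s us /(perm_reindex c0 sz_s) ps.
by rewrite (perm_size ps) (perm_uniq ps).
Qed.

Lemma crossing_bicycle (A B : eqType) (a0 : A) (b0 : B) r f g k pat p q :
  uniq f -> uniq g -> 0 < k -> holds a0 b0 r f g pat ->
  on_board a0 b0 r f g p.1 p.2 -> on_board a0 b0 r f g q.1 q.2 ->
  cycle_closer 0 k (graph_of (pat ++ [:: p; q])) p.1 p.2 -> has_bicycle r k.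
Proof.
move=> uf ug k_gt0 h hp hq.
apply: (@cycle_closer_on_board _ _ a0 b0 r f g k k_gt0 uf ug _ _ _ _ hp).
by apply: subgraph_graph_of; rewrite all_cat -/(holds _ _ _ _ _ _) h /= hp hq.
Qed.

(** If a square row has only red edges to the hexagon columns, the first refutation applies.
    Otherwise both square rows have a blue edge there: distinct columns give a blue $C_8$, and a
    common column is rotated to [0]. *)
Lemma board8_red (A B : eqType) (a0 : A) (b0 : B) r f g :
  size f = 8 -> size g = 8 -> uniq f -> uniq g ->
  holds a0 b0 (non r) f g (hexagon ++ shift 3 square) ->
  holds a0 b0 r f g (block 0 3 3 2) ->
  has_bicycle r 4 \/ has_bicycle (non r) 4.
Proof.
move=> sf sg uf ug h red.
have [red1|[p p_in bp]] := @holdsPn _ _ a0 b0 r f g 8 (block 3 1 0 3) sf sg isT.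
  apply: (refuted_goal refuted_hexagon_square8 sf sg uf ug h _
    (cycle_closer_on_board _ uf ug)) => //.
  by rewrite holds_pat_cat red.
have [red1|[q q_in bq]] := @holdsPn _ _ a0 b0 r f g 8 (block 4 1 0 3) sf sg isT.
  (* Exchanges the two rows of the square. *)
  pose l := [:: 0; 1; 2; 4; 3; 5; 6; 7].
  have [sf' uf'] := reindex_board a0 sf uf (isT : perm_eq l (iota 0 8)).
  have [sg' ug'] := reindex_board b0 sg ug (perm_refl (iota 0 8)).
  apply: (refuted_goal refuted_hexagon_square8 sf' sg' uf' ug' _ _
    (cycle_closer_on_board _ uf' ug')) => //.
    exact: holds_reindex h.
  have /holds_reindex: holds a0 b0 r f g (block 0 3 3 2 ++ block 4 1 0 3).
    by rewrite holds_pat_cat red.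
  exact.
have /orP[/eqP eq_pq | crossed] := allP (allP diagonal8 _ p_in) _ q_in; last first.
  by right; apply: crossing_bicycle h bp bq crossed.
have [k k_lt [def_p def_q]] : exists2 k, k \in iota 0 3 & p = (3, k) /\ q = (4, k).
  exists p.2; first by move: p_in; rewrite !inE => /or3P[] /eqP->.
  rewrite {2}eq_pq; move: p_in q_in; rewrite !inE.
  by split; [case/or3P: p_in | case/or3P: q_in] => /eqP->.
have /and3P[pl re_blue re_red] := allP rotation_reindexes _ k_lt.
have [sf' uf'] := reindex_board a0 sf uf pl.
have [sg' ug'] := reindex_board b0 sg ug pl.
apply: (refuted_goal refuted_hexagon_square8_pinned sf' sg' uf' ug' _
  (holds_reindex re_red red) (cycle_closer_on_board _ uf' ug')) => //.
by apply: holds_reindex re_blue _; rewrite -def_p -def_q holds_pat_cat h /= bp bq.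
Qed.

(** A blue hexagon lies in a $K_{6,6}$ and a blue square in the $K_{5,5}$ that avoids the
    hexagon. *)
Lemma board8_bicycle (A B : eqType) (a0 : A) (b0 : B) (r : A -> B -> bool)
    (X : seq A) (Y : seq B) :
  size X = 8 -> size Y = 8 -> uniq X -> uniq Y ->
  has_bicycle r 4 \/ has_bicycle (non r) 4.
Proof.
move=> sX sY uX uY.
have := @board6_hexagon _ _ a0 b0 r (take 6 X) (take 6 Y).
rewrite !size_takel ?sX ?sY // !take_uniq // => /(_ erefl erefl isT isT).
case=> [|/(occurs_cat (drop 6 X) (drop 6 Y))]; first by left.
rewrite !cat_take_drop => -[X' [Y' [pX pY h]]].
rewrite -(perm_size pX) in sX; rewrite -(perm_size pY) in sY.
rewrite -(perm_uniq pX) in uX; rewrite -(perm_uniq pY) in uY.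
have := @board5_square _ _ a0 b0 r (drop 3 X') (drop 3 Y').
rewrite !size_drop sX sY !drop_uniq // => /(_ erefl erefl isT isT).
case=> [|sq]; first by left.
have [|||X1 [Y1 [pX1 pY1 h1]]] := assemble _ _ _ h sq; rewrite ?sX ?sY //.
have qX := perm_take_drop pX1; have qY := perm_take_drop pY1.
move: (take 3 X' ++ X1) (take 3 Y' ++ Y1) qX qY h1 => f g qX qY h1.
rewrite -(perm_size qX) in sX; rewrite -(perm_size qY) in sY.
rewrite -(perm_uniq qX) in uX; rewrite -(perm_uniq qY) in uY.
have [red|[p p_in bp]] := @holdsPn _ _ a0 b0 r f g 8 (block 0 3 3 2) sX sY isT.
  exact: board8_red h1 red.
have [red|[q q_in bq]] := @holdsPn _ _ a0 b0 r f g 8 (block 3 2 0 3) sX sY isT.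
  (* Reversing the three hexagon positions on both sides undoes the effect of the transposition on
     its edges. *)
  pose l := [:: 2; 1; 0; 3; 4; 5; 6; 7].
  have [sf uf] := reindex_board a0 sX uX (isT : perm_eq l (iota 0 8)).
  have [sg ug] := reindex_board b0 sY uY (isT : perm_eq l (iota 0 8)).
  have [] := @board8_red _ _ b0 a0 (flip2 r) _ _ sg sf ug uf.
  - exact: holds_reindex (holds_flip h1).
  - exact: holds_reindex (holds_flip red).
  - by move/has_bicycle_flip; left.
  - by move/has_bicycle_flip; right.
by right; apply: crossing_bicycle h1 bp bq (allP (allP crossing8 _ p_in) _ q_in).
Qed.

(** * Lengthening a blue cycle *)

(** A path on ten vertices of the board with the same ends as the window. *)
Definition detour (A B : eqType) (a0 : A) (b0 : B) (r : A -> B -> bool) f g :=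
  exists u v, [/\ size u = 4, uniq (nth a0 f 0 :: u), uniq (nth b0 g 3 :: v),
    bipath r (nth a0 f 0) u v (nth b0 g 3)
    & {subset u <= f} /\ {subset v <= g}].

Lemma detour_closer_on_board (A B : eqType) (a0 : A) (b0 : B) r f g :
  uniq f -> uniq g ->
  closer_sound (on_board a0 b0 r f g) (detour a0 b0 r f g) detour_closer.
Proof.
move=> uf ug; apply: closer_sound_imp (@detour_closerP _).
case=> u [v [sz_u u_uniq v_uniq pth]].
have [uF uG pthFG subu subv] := bipath_on_board uf ug u_uniq v_uniq pth.
by exists (map (nth a0 f) u), (map (nth b0 g) v); rewrite size_map.
Qed.

Lemma detour_perm (A B : eqType) (a0 : A) (b0 : B) r f g f' g' :
  perm_eq f' f -> perm_eq g' g ->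
  nth a0 f' 0 = nth a0 f 0 -> nth b0 g' 3 = nth b0 g 3 ->
  detour a0 b0 r f' g' -> detour a0 b0 r f g.
Proof.
move=> pf pg f0 g3 [u [v]]; rewrite f0 g3 => -[sz_u uu uv pth [uf vg]].
exists u, v; split=> //; split=> z.
  by move/uf; rewrite (perm_mem pf).
by move/vg; rewrite (perm_mem pg).
Qed.

(** Transposing the board and reversing the first four positions maps the window to itself with its
    ends exchanged. *)
Definition window_reversal := [:: 3; 2; 1; 0; 4; 5; 6; 7].

Lemma detour_flip (A B : eqType) (a0 : A) (b0 : B) r f g :
  size f = 8 -> size g = 8 ->
  detour b0 a0 (flip2 r) (map (nth b0 g) window_reversal)
    (map (nth a0 f) window_reversal) ->
  detour a0 b0 r f g.
Proof.
move=> sf sg [v [u [sz_v uv uu pth [vg uf]]]]; exists (rev u), (rev v).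
have pf := perm_reindex a0 sf (isT : perm_eq window_reversal (iota 0 8)).
have pg := perm_reindex b0 sg (isT : perm_eq window_reversal (iota 0 8)).
rewrite size_rev (bipath_size pth) sz_v; split=> //.
- by move: uu; rewrite /= rev_uniq mem_rev.
- by move: uv; rewrite /= rev_uniq mem_rev.
- exact: bipath_rev pth.
split=> z; rewrite mem_rev.
  by move/uf; rewrite (perm_mem pf).
by move/vg; rewrite (perm_mem pg).
Qed.

(** For [i] equal to [4] or [5], brings position [i] to position [4]. *)
Definition swap45 (i : nat) :=
  if i == 4 then iota 0 8 else [:: 0; 1; 2; 3; 5; 4; 6; 7].

Lemma swap45_reindexes : all (fun p => all (fun q =>
    reindexes (swap45 q.1) (swap45 p.2) ((window ++ shift 4 square) ++ [:: p; q])
      (window ++ shift 4 square ++ [:: (4, q.2); (p.1, 4)]))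
  (block 4 2 0 4)) (block 0 4 4 2).
Proof. by vm_compute. Qed.

(** If all edges between window and square in one direction are red, the refutation applies to the
    board or its reversed transpose. Otherwise there is a blue edge in each direction, and
    exchanging positions [4] and [5] gives one of the sixteen pinned cases. *)
Lemma window_squares (A B : eqType) (a0 : A) (b0 : B) r f g :
  size f = 8 -> size g = 8 -> uniq f -> uniq g ->
  holds a0 b0 (non r) f g (window ++ shift 4 square) ->
  has_bicycle r 4 \/ detour a0 b0 (non r) f g.
Proof.
move=> sf sg uf ug h.
have [red|[p p_in bp]] := @holdsPn _ _ a0 b0 r f g 8 (block 0 4 4 2) sf sg isT.
  exact: (refuted_goal refuted_window_square sf sg uf ug h red
    (detour_closer_on_board uf ug)).
have [red|[q q_in bq]] := @holdsPn _ _ a0 b0 r f g 8 (block 4 2 0 4) sf sg isT.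
  have pl := isT : perm_eq window_reversal (iota 0 8).
  have [sf' uf'] := reindex_board a0 sf uf pl.
  have [sg' ug'] := reindex_board b0 sg ug pl.
  have h' := holds_reindex (isT : reindexes window_reversal window_reversal
    (transpose (window ++ shift 4 square)) (window ++ shift 4 square)) (holds_flip h).
  have red' := holds_reindex (isT : reindexes window_reversal window_reversal
    (transpose (block 4 2 0 4)) (block 0 4 4 2)) (holds_flip red).
  have [/has_bicycle_flip|/detour_flip] :=
    refuted_goal refuted_window_square sg' sf' ug' uf' h' red'
      (detour_closer_on_board ug' uf').
    by left.
  by right; auto.
have pl i : perm_eq (swap45 i) (iota 0 8) by rewrite /swap45; case: ifP.
have [sf' uf'] := reindex_board a0 sf uf (pl q.1).
have [sg' ug'] := reindex_board b0 sg ug (pl p.2).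
have h' : holds a0 b0 (non r) f g ((window ++ shift 4 square) ++ [:: p; q]).
  by rewrite holds_pat_cat h /= bp bq.
have q2 : q.2 \in iota 0 4 by case/allpairsP: q_in => [[? ?] [_ ? ->]].
have p1 : p.1 \in iota 0 4 by case/allpairsP: p_in => [[? ?] [? _ ->]].
have refd := allP refuted_window_square_pinned _ (allpairs_f pair q2 p1).
have h1 := holds_reindex (allP (allP swap45_reindexes _ p_in) _ q_in) h'.
have [|det] := refuted_goal refd sf' sg' uf' ug' h1 isT
  (detour_closer_on_board uf' ug').
  by left.
right; apply: detour_perm det.
- exact: perm_reindex (pl _).
- exact: perm_reindex (pl _).
- by rewrite /swap45; case: ifP.
- by rewrite /swap45; case: ifP.
Qed.

(** Only vertices off the window are reordered, so the ends of the path stay in place and a detour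
    carries over. *)
Lemma window_board (A B : eqType) (a0 : A) (b0 : B) r X Y pat :
  size X = 8 -> size Y = 8 -> uniq X -> uniq Y ->
  holds a0 b0 (non r) X Y window ->
  occurs a0 b0 (non r) pat (drop 4 X) (drop 4 Y) ->
  exists f g, [/\ [/\ size f = 8, size g = 8, uniq f & uniq g],
    perm_eq (drop 4 f) (drop 4 X), perm_eq (drop 4 g) (drop 4 Y),
    holds a0 b0 (non r) f g (window ++ shift 4 pat)
    & detour a0 b0 (non r) f g -> detour a0 b0 (non r) X Y].
Proof.
move=> sX sY uX uY h occ.
have [|||X1 [Y1 [pX pY h1]]] := assemble _ _ _ h occ; rewrite ?sX ?sY //.
have qX := perm_take_drop pX; have qY := perm_take_drop pY.
exists (take 4 X ++ X1), (take 4 Y ++ Y1).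
rewrite (perm_size qX) (perm_size qY) (perm_uniq qX) (perm_uniq qY).
rewrite !drop_cat !size_takel ?sX ?sY // !drop0; split=> //.
by apply: detour_perm => //; rewrite nth_cat size_takel ?sX ?sY // nth_take.
Qed.

Lemma window_star (A B : eqType) (a0 : A) (b0 : B) r X Y :
  size X = 8 -> size Y = 8 -> uniq X -> uniq Y ->
  holds a0 b0 (non r) X Y window ->
  occurs a0 b0 (non r) star (drop 4 X) (drop 4 Y) ->
  [\/ has_bicycle r 4, detour a0 b0 (non r) X Y
    | occurs a0 b0 (non r) square (drop 4 X) (drop 4 Y)].
Proof.
move=> sX sY uX uY h st.
have [f [g [[sf sg uf ug] pX pY h1 det]]] := window_board sX sY uX uY h st.
have [|bic|[/det|sq]] := refuted_goal
  (goal := detour a0 b0 (non r) f g \/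
           occurs a0 b0 (non r) square (drop 4 f) (drop 4 g))
  refuted_window_star sf sg uf ug h1 isT.
- apply: or_closerP.
    apply: closer_sound_imp (detour_closer_on_board uf ug); by left.
  have sz4 : size (take 4 f) = 4 by rewrite size_takel ?sf.
  have sz4' : size (take 4 f) = size (take 4 g) by rewrite !size_takel ?sf ?sg.
  have [uX' uY'] : uniq (drop 4 f) /\ uniq (drop 4 g) by rewrite !drop_uniq.
  rewrite -[X in cycle_closer X]sz4 -[X in on_board _ _ _ X _](cat_take_drop 4 f).
  rewrite -[X in on_board _ _ _ _ X](cat_take_drop 4 g).
  apply: closer_sound_imp (@square_closer_occurs _ _ a0 b0 _ _ _ _ _ uX' uY' sz4').
  by right.
- exact: Or31.
- exact: Or32.
- by apply: Or33; apply: occurs_perm sq.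
Qed.

(** Case analysis on the $K_{4,4}$ off the window: a star yields a square or a detour, a hexagon
    yields a detour or one of the other cases, and squares are settled by [window_squares]. *)
Lemma window_extension (A B : eqType) (a0 : A) (b0 : B) r X Y :
  size X = 8 -> size Y = 8 -> uniq X -> uniq Y ->
  holds a0 b0 (non r) X Y window ->
  has_bicycle r 4 \/ detour a0 b0 (non r) X Y.
Proof.
move=> sX sY uX uY h.
have [uX4 uY4] : uniq (drop 4 X) /\ uniq (drop 4 Y) by rewrite !drop_uniq.
have square_case : occurs a0 b0 (non r) square (drop 4 X) (drop 4 Y) ->
    has_bicycle r 4 \/ detour a0 b0 (non r) X Y.
  move/(window_board sX sY uX uY h)=> [f [g [[sf sg uf ug] _ _ h1 det]]].
  by case: (window_squares sf sg uf ug h1) => [|/det]; [left | right].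
have star_case : occurs a0 b0 (non r) star (drop 4 X) (drop 4 Y) ->
    has_bicycle r 4 \/ detour a0 b0 (non r) X Y.
  by case/(window_star sX sY uX uY h)=> [||/square_case //]; [left | right].
have column_case : occurs a0 b0 (non r) column_star (drop 4 X) (drop 4 Y) ->
    has_bicycle r 4 \/ detour a0 b0 (non r) X Y.
  have pl := isT : perm_eq window_reversal (iota 0 8).
  have [sX' uX'] := reindex_board a0 sX uX pl.
  have [sY' uY'] := reindex_board b0 sY uY pl.
  have h' := holds_reindex (isT : reindexes window_reversal window_reversal
    (transpose window) window) (holds_flip h).
  have drop_rev (C : eqType) (c0 : C) (s : seq C) : size s = 8 ->
      drop 4 (map (nth c0 s) window_reversal) = drop 4 s.
    by do 9?[case: s => [|? s] //].
  move/column_star_flip=> st.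
  have := @window_star _ _ b0 a0 (flip2 r) _ _ sY' sX' uY' uX' h'.
  rewrite !drop_rev // => /(_ st)[/has_bicycle_flip|/detour_flip|].
  - by left.
  - by right; auto.
  - by move/(square_flip uY4 uX4)/square_case.
have [||||bic|[//|//|//|hex]] := @board4_occurs _ _ a0 b0 r (drop 4 X) (drop 4 Y).
- by rewrite size_drop sX.
- by rewrite size_drop sY.
- by [].
- by [].
- by left.
have [f [g [[sf sg uf ug] pX pY h1 det]]] := window_board sX sY uX uY h hex.
have [|bic|[/det|/square_case|/star_case|/column_case]] := refuted_goal
  (goal := [\/ detour a0 b0 (non r) f g,
  occurs a0 b0 (non r) square (drop 4 X) (drop 4 Y),
  occurs a0 b0 (non r) star (drop 4 X) (drop 4 Y)
  | occurs a0 b0 (non r) column_star (drop 4 X) (drop 4 Y)])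
  refuted_window_hexagon sf sg uf ug h1 isT.
- apply: or_closerP.
    apply: closer_sound_imp (detour_closer_on_board uf ug); exact: Or41.
  have sz4 : size (take 4 f) = 4 by rewrite size_takel ?sf.
  have sz4' : size (take 4 f) = size (take 4 g) by rewrite !size_takel ?sf ?sg.
  have [uX' uY'] : uniq (drop 4 f) /\ uniq (drop 4 g) by rewrite !drop_uniq.
  rewrite -[X in cycle_closer X]sz4 -[X in row_star_closer X]sz4.
  rewrite -[X in column_star_closer X]sz4.
  rewrite -[X in on_board _ _ _ X _](cat_take_drop 4 f).
  rewrite -[X in on_board _ _ _ _ X](cat_take_drop 4 g).
  apply: or_closerP; last apply: or_closerP.
  + apply: closer_sound_imp
      (@square_closer_occurs _ _ a0 b0 _ _ _ _ _ uX' uY' sz4').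
    by move/(occurs_perm pX pY); apply: Or42.
  + apply: closer_sound_imp
      (@star_closer_occurs _ _ a0 b0 _ _ _ _ _ uX' uY' sz4').
    by move/(occurs_perm pX pY); apply: Or43.
  + apply: closer_sound_imp
      (@column_star_closer_occurs _ _ a0 b0 _ _ _ _ _ uX' uY' sz4').
    by move/(occurs_perm pX pY); apply: Or44.
- by left.
- by right.
- by [].
- by [].
- by [].
Qed.

(** * Blue cycles of every length *)

Lemma occurs_square_bicycle (A B : eqType) (a0 : A) (b0 : B) r X Y :
  uniq X -> uniq Y -> occurs a0 b0 r square X Y -> has_bicycle r 2.
Proof.
move=> uX uY [X' [Y' [pX pY /and5P[h0 h1 h2 h3 _]]]].
rewrite -(perm_uniq pX) in uX; rewrite -(perm_uniq pY) in uY.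
apply: (@has_bicycle_on_board _ _ a0 b0 _ X' Y') => //.
by exists 0, [:: 1], [:: 0], 1; split=> //; rewrite /bicycle /= h0 h1 h2 h3.
Qed.

Lemma occurs_hexagon_bicycle (A B : eqType) (a0 : A) (b0 : B) r X Y :
  uniq X -> uniq Y -> occurs a0 b0 r hexagon X Y -> has_bicycle r 3.
Proof.
move=> uX uY [X' [Y' [pX pY /and5P[h0 h1 h2 h3 /and3P[h4 h5 _]]]]].
rewrite -(perm_uniq pX) in uX; rewrite -(perm_uniq pY) in uY.
apply: (@has_bicycle_on_board _ _ a0 b0 _ X' Y') => //.
exists 0, [:: 1; 2], [:: 0; 1], 2; split=> //.
by rewrite /bicycle /= h0 h1 h2 h3 h4 h5.
Qed.

Lemma leftover (C : finType) (s : seq C) k : uniq s -> size s + k <= #|C| ->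
  exists X, size X = k /\ uniq (s ++ X).
Proof.
move=> us sk; exists (take k (enum [predC s])); split.
  rewrite size_takel // -cardE -(leq_add2l #|s|) cardC.
  by move/card_uniqP: us => ->.
rewrite cat_uniq us take_uniq ?enum_uniq // andbT; apply/hasPn=> x /mem_take.
by rewrite mem_enum.
Qed.

Lemma path_detour (A B : eqType) (r : A -> B -> bool) a u v b X Y :
  size u = 3 -> size X = 4 -> size Y = 4 ->
  uniq (a :: u ++ X) -> uniq (b :: v ++ Y) -> bipath (non r) a u v b ->
  has_bicycle r 4 \/ exists u' v', [/\ size u' = 4, uniq (a :: u'),
    uniq (b :: v'), bipath (non r) a u' v' b
    & {subset u' <= u ++ X} /\ {subset v' <= v ++ Y}].
Proof.
move=> sz_u sX sY uaX ubY pth; have sz_v := bipath_size pth.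
case: u sz_u uaX pth sz_v => [|a1 [|a2 [|a3 [|? ?]]]] //= _ uaX.
case: v ubY => [|b1 [|b2 [|b3 [|? ?]]]] //= ubY.
case/and5P=> h0 h1 h2 h3 /and3P[h4 h5 h6] _.
(* The columns are listed in path order, which puts [a] at position [0] and [b] at position [3], as
   the window requires. *)
have [|||||//|[u [v [sz_u uu uv pth [uf vg]]]]] := @window_extension _ _ a b r
  ([:: a; a1; a2; a3] ++ X) ([:: b1; b2; b3; b] ++ Y).
- by rewrite size_cat sX.
- by rewrite size_cat sY.
- by [].
- by rewrite (uniq_catCA [:: b1; b2; b3] [:: b] Y).
- by rewrite /holds /on_board /= h0 h1 h2 h3 h4 h5 h6.
- by left.
right; exists u, v; split=> //; split=> z z_in.
  have := uf _ z_in; rewrite inE => /predU1P[za|//].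
  by move: uu; rewrite /= -za z_in.
have /negbTE z_b : z != b by apply: contraTneq z_in => ->; case/andP: uv.
by have := vg _ z_in; rewrite !(mem_cat, inE) z_b orbF -!orbA.
Qed.

Lemma perm_swap_heads (C : eqType) (x y : C) s t :
  perm_eq (x :: s ++ y :: t) (y :: s ++ x :: t).
Proof.
apply/permP=> p; rewrite /= !count_cat /= !addnA; congr (_ + _).
by rewrite [_ + p y]addnC [p x + _]addnC addnA.
Qed.

Lemma bicycle_step (A B : finType) (r : A -> B -> bool) m :
  4 <= m -> m + 4 <= #|A| -> m + 4 <= #|B| ->
  has_bicycle (non r) m -> has_bicycle r 4 \/ has_bicycle (non r) m.+1.
Proof.
move=> m4 mA mB [a [u [v [b [sz_u /and4P[ua ub pth rab]]]]]].
have sz_v := bipath_size pth.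
have [|X [sX uX]] := leftover (k := 4) ua; first by rewrite /= sz_u.
have [|Y [sY uY]] := leftover (k := 4) ub; first by rewrite /= sz_v sz_u.
(* For [m = 4] the window is the whole cycle, and the edge from [a] to [b] closes the detour.
   Otherwise the cycle is cut after the right vertex [b1], and the detour replaces the part from [a]
   to [b1]. *)
have [m_eq4|m_neq4] := eqVneq m 4.
  have [|//|[u' [v' [sz_u' uu' uv' pth' _]]]] := path_detour _ sX sY uX uY pth.
  - by move: sz_u; rewrite m_eq4 => -[].
  - by left.
  right; exists a, u', v', b; rewrite sz_u' m_eq4; split=> //.
  by apply/and4P.
have sz3 : 3 < size u.
  by rewrite -ltnS sz_u ltn_neqAle eq_sym m_neq4.
have [a2 [u2 def_u2]] : exists a2 u2, drop 3 u = a2 :: u2.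
  case E: (drop 3 u) => [|a2 u2]; last by exists a2, u2.
  by move: (size_drop 3 u); rewrite E => /esym/eqP; rewrite subn_eq0 leqNgt sz3.
have [b1 [v2 def_v2]] : exists b1 v2, drop 3 v = b1 :: v2.
  case E: (drop 3 v) => [|b1 v2]; last by exists b1, v2.
  by move: (size_drop 3 v); rewrite E sz_v => /esym/eqP; rewrite subn_eq0 leqNgt sz3.
have def_u : u = take 3 u ++ a2 :: u2 by rewrite -def_u2 cat_take_drop.
have def_v : v = take 3 v ++ b1 :: v2 by rewrite -def_v2 cat_take_drop.
have sz_u1 : size (take 3 u) = 3 by rewrite size_takel // ltnW.
have sz_v1 : size (take 3 v) = 3 by rewrite size_takel // sz_v ltnW.
move: (take 3 u) (take 3 v) def_u def_v sz_u1 sz_v1 => u1 v1 def_u def_v sz_u1 sz_v1.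
move: pth; rewrite def_u def_v bipath_cat ?sz_u1 ?sz_v1 // => /and3P[pth1 ra2b1 pth2].
(* The new interior vertices come from the old interior or from off the cycle, hence avoid the rest
   [t] of the cycle. *)
have split_uniq (C : eqType) (c : C) s t Z :
    uniq ((c :: s ++ t) ++ Z) -> uniq (c :: s ++ Z) /\
    forall s', uniq (c :: s') -> {subset s' <= s ++ Z} -> uniq (c :: s' ++ t).
  move=> uc; have {uc}: uniq ((c :: s ++ Z) ++ t).
    rewrite (perm_uniq (_ : perm_eq _ ((c :: s ++ t) ++ Z))) //.
    by rewrite !cat_cons perm_cons perm_catAC.
  rewrite cat_uniq => /and3P[ucZ /hasPn dis ut]; split=> // s' us' sub.
  rewrite -cat_cons cat_uniq us' ut andbT; apply/hasPn=> x xt.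
  have := dis x xt; rewrite /= !inE !negb_or => /andP[-> /=].
  by apply: contra => /sub.
rewrite def_u in uX; have [uX1 extA] := split_uniq _ _ _ _ _ uX.
(* The first segment ends at [b1] and the whole path at [b], so the two exchange places in the list
   of right vertices. *)
have [|uY1 extB] := split_uniq _ b1 v1 (b :: v2) Y.
  move: uY; rewrite def_v; congr is_true; apply/perm_uniq.
  by rewrite perm_cat2r perm_swap_heads.
have [//|[u' [v' [sz_u' uu' uv' pth' [sub_u sub_v]]]]] :=
  path_detour sz_u1 sX sY uX1 uY1 pth1; first by left.
right; exists a, (u' ++ a2 :: u2), (v' ++ b1 :: v2), b; split.
  by move: sz_u; rewrite def_u !size_cat sz_u' sz_u1 => <-.
apply/and4P; split=> //; first exact: extA.
  by rewrite (perm_uniq (perm_swap_heads _ _ _ _)); apply: extB.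
by rewrite bipath_cat ?(bipath_size pth') // pth' ra2b1.
Qed.

(** Induction from the $C_8$ in $K_{8,8}$. The step to [n.+1] needs [n + 4] vertices on each side,
    which is the bound for [n.+1]. *)
Lemma has_bicycle_large (A B : finType) (r : A -> B -> bool) n : 4 <= n ->
  8 <= #|A| -> 8 <= #|B| -> n + 3 <= #|A| -> n + 3 <= #|B| ->
  has_bicycle r 4 \/ has_bicycle (non r) n.
Proof.
move=> n4 A8 B8; have /card_gt0P[a0 _] : 0 < #|A| by apply: leq_trans A8.
have /card_gt0P[b0 _] : 0 < #|B| by apply: leq_trans B8.
elim: n n4 => // n IH; rewrite leq_eqVlt => /predU1P[<- _ _|n4 nA nB].
  have [X [sX uX]] := leftover (s := [::] : seq A) isT A8.
  have [Y [sY uY]] := leftover (s := [::] : seq B) isT B8.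
  exact: board8_bicycle sX sY uX uY.
have [|||bic|bic] := IH.
- by [].
- exact: leq_trans (leqnSn _) nA.
- exact: leq_trans (leqnSn _) nB.
- by left.
by apply: bicycle_step bic => //; rewrite addnS -addSn.
Qed.

Lemma has_bicycle_bound (A B : finType) (r : A -> B -> bool) n : 2 <= n ->
  (if n == 4 then 8 else n + 3) <= #|A| -> (if n == 4 then 8 else n + 3) <= #|B| ->
  has_bicycle r 4 \/ has_bicycle (non r) n.
Proof.
move=> n2 nA nB.
have bound_gt0 : 0 < (if n == 4 then 8 else n + 3) by case: ifP; rewrite ?addnS.
have /card_gt0P[a0 _] : 0 < #|A| by apply: leq_trans nA.
have /card_gt0P[b0 _] : 0 < #|B| by apply: leq_trans nB.
have [X [sX uX]] := leftover (s := [::] : seq A) isT nA.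
have [Y [sY uY]] := leftover (s := [::] : seq B) isT nB.
(* The surviving cases are [n = 2], [n = 3], [n = 4] and [n >= 5]. *)
case: n n2 {bound_gt0} nA nB sX sY => [|[|[|[|[|n]]]]] //= _ nA nB sX sY.
- case: (@board5_square _ _ a0 b0 r X Y sX sY uX uY) => [|sq]; first by left.
  by right; apply: occurs_square_bicycle sq.
- case: (@board6_hexagon _ _ a0 b0 r X Y sX sY uX uY) => [|hex]; first by left.
  by right; apply: occurs_hexagon_bicycle hex.
- by apply: has_bicycle_large => //; [apply: leq_trans nA | apply: leq_trans nB].
- apply: has_bicycle_large => //; [apply: leq_trans nA | apply: leq_trans nB];
  by rewrite addnC.
Qed.

(** * Cycles and monochromatic copies *)

Lemma bipathP (A B : Type) (a0 : A) (b0 : B) (r : A -> B -> bool) a u v b :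
  size v = size u ->
  bipath r a u v b <->
  (forall t, t <= size u -> r (nth a0 (a :: u) t) (nth b0 (rcons v b) t)) /\
  (forall t, t < size u -> r (nth a0 u t) (nth b0 (rcons v b) t)).
Proof.
elim: u a v => [|a' u IH] a [|b' v] //= => [_|[sz_v]].
  by split=> [rab|[/(_ 0 isT)]] //; split=> [[]|].
split=> [/and3P[rab' ra'b' /(IH _ _ sz_v)[IH1 IH2]]|[H1 H2]].
  by split=> [[|t]|[|t]] //=; [apply: IH1 | apply: IH2].
rewrite (H1 0) // (H2 0) //=; apply/(IH _ _ sz_v).
by split=> t t_lt; [apply: (H1 t.+1) | apply: (H2 t.+1)].
Qed.

Lemma has_bicycle_sub (A B : eqType) (r r' : A -> B -> bool) k :
  (forall x y, r x y -> r' x y) -> has_bicycle r k -> has_bicycle r' k.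
Proof.
move=> rr' [a [u [v [b [sz_u /and4P[ua ub pth rab]]]]]].
exists a, u, v, b; split=> //; rewrite /bicycle ua ub rr' // andbT /=.
by have := bipath_map (f := id) (g := id) rr' pth; rewrite !map_id.
Qed.

Definition eq_color (k k' : color) : bool :=
  match k, k' with
  | color1, color1 | color2, color2 => true
  | _, _ => false
  end.

Lemma eq_colorP k k' : reflect (k = k') (eq_color k k').
Proof. by case: k; case: k'; constructor. Qed.

Definition color_class b (c : edge_coloring (Kbip b b)) (k : color) :
    'I_b -> 'I_b -> bool :=
  fun i j => eq_color (c (inl i) (inr j)) k.

Lemma mono_copy_of_bicycle b (c : edge_coloring (Kbip b b)) k n :
  has_bicycle (color_class c k) n -> has_mono_copy c k (cycle_graph (2 * n)).
Proof.
case=> a [u [v [b' [sz_u /and4P[ua ub pth rab]]]]].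
have sz_v := bipath_size pth; have [up down] := (bipathP a b' _ a b' sz_v).1 pth.
(* The cycle in order: position [2t] is the left vertex of index [t], and position [2t+1] the right
   one. *)
pose F i : Kbip b b := if odd i then inr (nth b' (rcons v b') i./2)
                       else inl (nth a (a :: u) i./2).
have half_lt i : i < 2 * n -> i./2 < n by rewrite ltn_half_double mul2n.
pose link (x y : Kbip b b) := Kbip_adj x y /\ c x y = k.
have linkC x y : link x y -> link y x.
  by case=> xy cxy; rewrite /link Kbip_adj_sym color_of_sym.
have F_link i : i < 2 * n -> link (F i) (F (i.+1 %% (2 * n))).
  move=> i_lt; have t_lt := half_lt _ i_lt.
  have := odd_double_half i; move: i./2 t_lt (odd i) => t t_lt [] def_i.
  - have [t1|] := ltnP t.+1 n.
      rewrite modn_small; last first.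
        by rewrite -def_i add1n -doubleS -mul2n ltn_pmul2l.
      rewrite -def_i /F /= odd_double /= uphalf_double half_double /=.
      apply/linkC; split=> //; apply/eq_colorP/down.
      by rewrite -ltnS sz_u.
    move=> n_le; have /eqP def_n : t.+1 == n by rewrite eqn_leq t_lt.
    have -> : i.+1 = 2 * n by rewrite -def_i add1n -doubleS def_n mul2n.
    (* The wrap-around edge is the closing edge from [a] to [b']. *)
    rewrite modnn -def_i /F /= odd_double /= uphalf_double.
    apply/linkC; split=> //; apply/eq_colorP.
    have -> : t = size v by apply/eqP; rewrite sz_v -eqSS sz_u def_n.
    by rewrite nth_rcons ltnn eqxx.
  - rewrite modn_small; last first.
      by rewrite -def_i add0n mul2n -doubleS leq_double.
    rewrite -def_i /F /= odd_double /= uphalf_double half_double /=.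
    split=> //; apply/eq_colorP/up.
    by rewrite -ltnS sz_u.
exists (fun i : 'I_(2 * n) => F i); split=> [i j|i j].
  move=> Fij; apply: val_inj => /=.
  rewrite -(odd_double_half i) -(odd_double_half j).
  have [it jt] := (half_lt _ (ltn_ord i), half_lt _ (ltn_ord j)).
  have ub' : uniq (rcons v b') by rewrite rcons_uniq.
  move: Fij; rewrite /F; case: (odd i); case: (odd j) => // -[] /eqP.
    by rewrite nth_uniq ?size_rcons ?sz_v ?sz_u // => /eqP->.
  by rewrite nth_uniq /= ?sz_u // => /eqP->.
rewrite /= /cycle_adj => /andP[_ /orP[/eqP->|/eqP->]]; first exact: F_link.
by apply/linkC/F_link.
Qed.

Lemma bicycle_of_functions (A B : eqType) (r : A -> B -> bool) n (F : nat -> A)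
    (G : nat -> B) : 0 < n ->
  {in gtn n &, injective F} -> {in gtn n &, injective G} ->
  (forall t, t < n -> r (F t) (G t)) ->
  (forall t, t < n -> r (F (t.+1 %% n)) (G t)) -> has_bicycle r n.
Proof.
case: n => // n _ injF injG rFG rFG'.
exists (F 0), (mkseq (F \o succn) n), (mkseq G n), (G n).
rewrite size_mkseq; split=> //.
have def_F : F 0 :: mkseq (F \o succn) n = mkseq F n.+1.
  by rewrite /mkseq /= (iotaDl 1 0) -map_comp.
have def_G : rcons (mkseq G n) (G n) = mkseq G n.+1 by rewrite -mkseqS.
apply/and4P; split.
- by rewrite def_F; apply/mkseq_uniqP.
- by rewrite cons_uniq -rcons_uniq def_G; apply/mkseq_uniqP.
- apply/(bipathP (F 0) (G n)); rewrite ?size_mkseq // def_F def_G.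
  split=> t t_lt; rewrite !nth_mkseq //; first exact: rFG.
    by have := rFG' t; rewrite modn_small ?ltnS //; apply; apply: ltnW.
  exact: ltnW.
- by have := rFG' n (ltnSn n); rewrite modnn.
Qed.

Lemma bicycle_of_mono_copy b (c : edge_coloring (Kbip b b)) k n : 0 < n ->
  has_mono_copy c k (cycle_graph (2 * n)) -> has_bicycle (color_class c k) n.
Proof.
move=> n0 [f [inj_f f_adj]].
have n2_gt0 : 0 < 2 * n by rewrite muln_gt0.
(* Extends [f] periodically to all of [nat], so that successive vertices need no wrap-around
   case. *)
pose h i := f (Ordinal (ltn_pmod i n2_gt0)).
have h_mod i : h (i %% (2 * n)) = h i.
  by congr f; apply: val_inj; rewrite /= modn_mod.
have h_inj i j : i < 2 * n -> j < 2 * n -> h i = h j -> i = j.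
  by move=> i_lt j_lt /inj_f/(congr1 val) /=; rewrite !modn_small.
have h_link i : Kbip_adj (h i) (h i.+1) /\ c (h i) (h i.+1) = k.
  apply: f_adj; rewrite /= /cycle_adj; apply/andP; split.
    rewrite -val_eqE /= -[X in X %% _ == _]addn0 -[i.+1]addn1 eqn_modDl mod0n.
    by rewrite modn_small // mul2n -addnn (leq_add n0 n0).
  by apply/orP; left; rewrite -val_eqE /= -addn1 -[in X in _ == X]addn1 modnDml.
(* [p] and [q] are the two injections in either order, according to the side on which the copy
   starts. *)
have key (p q : 'I_b -> Kbip b b) F G : (forall t, h (2 * t) = p (F t)) ->
    (forall t, h (2 * t).+1 = q (G t)) ->
    has_bicycle (fun x y => eq_color (c (p x) (q y)) k) n.
  move=> hF hG; apply: (bicycle_of_functions (F := F) (G := G)) => //.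
  - move=> s t s_lt t_lt /(congr1 p); rewrite -!hF => /h_inj.
    rewrite !ltn_pmul2l // => /(_ s_lt t_lt)/eqP.
    by rewrite eqn_pmul2l // => /eqP.
  - have odd_lt s : s < n -> (2 * s).+1 < 2 * n.
      by rewrite !mul2n -[_.+1 < _]/(s.+1.*2 <= _) leq_double.
    move=> s t /odd_lt s_lt /odd_lt t_lt /(congr1 q); rewrite -!hG => /h_inj.
    move/(_ s_lt t_lt)/eqP; rewrite eqSS eqn_pmul2l // => /eqP.
    exact.
  - by move=> t _; apply/eq_colorP; rewrite -hF -hG; case: (h_link (2 * t)).
  - move=> t _; apply/eq_colorP; rewrite -hF -hG muln_modr h_mod mulnS !addSn add0n.
    by rewrite color_of_sym; case: (h_link (2 * t).+1).
case h0: (h 0) => [x0|x0].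
(* These maps strip the injection, with [x0] as an arbitrary default; [hlr] shows that the copy
   alternates sides and the default is never met. *)
- pose gl (x : Kbip b b) := if x is inl y then y else x0.
  pose gr (x : Kbip b b) := if x is inr y then y else x0.
  have hlr t : h (2 * t) = inl (gl (h (2 * t))) /\
      h (2 * t).+1 = inr (gr (h (2 * t).+1)).
    elim: t => [|t [IH1 IH2]].
      by rewrite muln0 h0; case: (h_link 0); rewrite h0; case: (h 1).
    have [] := h_link (2 * t).+1; rewrite mulnS !addSn add0n IH2.
    case E: (h (2 * t).+2) => [y|//] _ _; split=> //.
    by have [] := h_link (2 * t).+2; rewrite E; case: (h _).
  apply: (key inl inr (fun t => gl (h (2 * t))) (fun t => gr (h (2 * t).+1))) => t.
    by case: (hlr t).
  by case: (hlr t).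
- pose gl (x : Kbip b b) := if x is inl y then y else x0.
  pose gr (x : Kbip b b) := if x is inr y then y else x0.
  have hlr t : h (2 * t) = inr (gr (h (2 * t))) /\
      h (2 * t).+1 = inl (gl (h (2 * t).+1)).
    elim: t => [|t [IH1 IH2]].
      by rewrite muln0 h0; case: (h_link 0); rewrite h0; case: (h 1).
    have [] := h_link (2 * t).+1; rewrite mulnS !addSn add0n IH2.
    case E: (h (2 * t).+2) => [//|y] _ _; split=> //.
    by have [] := h_link (2 * t).+2; rewrite E; case: (h _).
  apply/has_bicycle_flip.
  have := key inr inl (fun t => gr (h (2 * t))) (fun t => gl (h (2 * t).+1)).
  move=> /(_ (fun t => (hlr t).1) (fun t => (hlr t).2)); apply: has_bicycle_sub.
  by move=> x y; rewrite /flip2 /color_class color_of_sym.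
Qed.

(** * Colorings for the lower bounds *)

Definition coloring_fun b (P : nat -> nat -> bool) (x y : Kbip b b) : color :=
  match x, y with
  | inl i, inr j | inr j, inl i => if P i j then color1 else color2
  | _, _ => color1
  end.

Lemma coloring_sym b P (x y : Kbip b b) : coloring_fun P x y = coloring_fun P y x.
Proof. by case: x; case: y. Qed.

Definition coloring b P := EdgeColoring (@coloring_sym b P).

Lemma coloring1 b P (i j : 'I_b) : color_class (coloring b P) color1 i j = P i j.
Proof. by rewrite /color_class /=; case: (P i j). Qed.

Lemma coloring2 b P (i j : 'I_b) : color_class (coloring b P) color2 i j = ~~ P i j.
Proof. by rewrite /color_class /=; case: (P i j). Qed.

Lemma few_rows b (r : 'I_b -> 'I_b -> bool) (s : seq nat) n :
  (forall i j, r i j -> val i \in s) -> has_bicycle r n -> n <= size s.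
Proof.
move=> rs [a [u [v [b' [<- /and4P[ua _ pth _]]]]]].
rewrite -[(size u).+1]/(size (a :: u)) -(size_map val); apply: uniq_leq_size.
  by rewrite (map_inj_uniq val_inj).
by move=> _ /mapP[x /(bipath_dom pth).1 [y /rs]] xs ->.
Qed.

Lemma arrows_bicycle b n c : 0 < n ->
  bip_arrows b (cycle_graph 8) (cycle_graph (2 * n)) ->
  has_bicycle (color_class c color1) 4 \/
  has_bicycle (@color_class b c color2) n.
Proof.
move=> n0 /(_ c)[copy|copy]; [left | right]; last exact: bicycle_of_mono_copy.
exact: (@bicycle_of_mono_copy _ c color1 4).
Qed.

Lemma arrows_lower b n : 0 < n ->
  bip_arrows b (cycle_graph 8) (cycle_graph (2 * n)) -> n + 3 <= b.
Proof.
move=> n0 arr.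
case: (arrows_bicycle (coloring b (fun i _ => i < 3)) n0 arr) => bic.
  suff: 4 <= size (iota 0 3) by [].
  by apply: few_rows bic => i j; rewrite coloring1 mem_iota.
suff: n <= size (iota 3 (b - 3)).
  (* Since [n] is positive, the truncated difference [b - 3] is positive too. *)
  rewrite size_iota => nb; have b3 : 3 < b by rewrite -subn_gt0 (leq_trans n0).
  by rewrite -(subnK (ltnW b3)) leq_add2r.
apply: few_rows bic => i j; rewrite coloring2 -leqNgt mem_iota => i3.
by rewrite i3 subnKC ?ltn_ord // ltnW // (leq_ltn_trans i3 (ltn_ord i)).
Qed.

(** An exhaustive counterpart of [search_path]: success excludes every path, where [search_path]
    only certifies one. *)
Fixpoint pathless (m : nat) (P : nat -> nat -> bool) (k a b : nat)
    (ua ub : seq nat) : bool :=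
  if k is k'.+1 then
    all (fun b' => if P a b' && (b' \notin ub) then
      all (fun a' => if P a' b' && (a' \notin ua) then
        pathless m P k' a' b (a' :: ua) (b' :: ub) else true) (iota 0 m)
      else true) (iota 0 m)
  else ~~ P a b.

Lemma pathlessP m P a u v b ua ub :
  pathless m P (size u) a b ua ub -> uniq u -> uniq v ->
  all (gtn m) u -> all (gtn m) v ->
  {in u, forall x, x \notin ua} -> {in v, forall y, y \notin ub} ->
  ~~ bipath P a u v b.
Proof.
elim: u a v ua ub => [|a' u IH] a [|b' v] ua ub //=.
move=> /allP no_path /andP[a'u uu] /andP[b'v uv] /andP[a'm um] /andP[b'm vm].
move=> u_ua v_ub.
apply/negP=> /and3P[Pab' Pa'b' pth].
have := no_path b'; rewrite mem_iota Pab' v_ub ?mem_head // => /(_ b'm)/allP/(_ a').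
rewrite mem_iota Pa'b' u_ua ?mem_head // => /(_ a'm) none.
suff /negP: ~~ bipath P a' u v b by [].
apply: IH none uu uv um vm _ _ => [x xu|y yv]; rewrite inE negb_or.
  rewrite u_ua ?inE ?xu ?orbT // andbT; by apply: contraNneq a'u => <-.
rewrite v_ub ?inE ?yv ?orbT // andbT; by apply: contraNneq b'v => <-.
Qed.

(** Vertices of a smaller board are among the first [m] numbers, so a single check on [m] vertices
    per side covers all [b <= m]. *)
Lemma no_bicycle m (P : nat -> nat -> bool) k b (r : 'I_b -> 'I_b -> bool) :
  b <= m -> (forall i j, r i j = P i j) ->
  all (fun x => all (fun y =>
    if P x y then pathless m P k x y [:: x] [:: y] else true) (iota 0 m))
    (iota 0 m) ->
  ~ has_bicycle r k.+1.
Proof.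
move=> bm rP no_path [a [u [v [b' [[sz_u] /and4P[]]]]]].
move=> /andP[au uu] /andP[bv uv] pth rab; have lt_m (i : 'I_b) : val i < m.
  exact: leq_trans (ltn_ord i) bm.
have in_iota (i : 'I_b) : val i \in iota 0 m by rewrite mem_iota lt_m.
have := allP (allP no_path _ (in_iota a)) _ (in_iota b'); rewrite -rP rab.
rewrite -sz_u -(size_map val) => none.
have pth' : bipath P (val a) (map val u) (map val v) (val b').
  by apply: bipath_map pth => x y; rewrite rP.
suff /negP: ~~ bipath P (val a) (map val u) (map val v) (val b') by [].
apply: pathlessP none _ _ _ _ _ _.
- by rewrite map_inj_uniq //; apply: val_inj.
- by rewrite map_inj_uniq //; apply: val_inj.
- by apply/allP=> _ /mapP[x _ ->]; apply: lt_m.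
- by apply/allP=> _ /mapP[x _ ->]; apply: lt_m.
- move=> _ /mapP[x xu ->]; rewrite inE; apply: contraNneq au.
  by move/val_inj <-.
- move=> _ /mapP[x xv ->]; rewrite inE; apply: contraNneq bv.
  by move/val_inj <-.
Qed.

(* Apart from the pendant edge [(6, 6)], the blocks of color 1 are [K_{4,3}]s
   that share row [6], and those of color 2 are [K_{3,4}]s that share column
   [6]. *)
Definition coloring77 (i j : nat) :=
  (i == 6) || ((j < 6) && ((i < 3) == (j < 3))).

Lemma arrows_lower4 b :
  bip_arrows b (cycle_graph 8) (cycle_graph 8) -> 8 <= b.
Proof.
move=> arr; rewrite leqNgt; apply/negP=> b7.
case: (@arrows_bicycle b 4 (coloring b coloring77) isT arr).
  apply: (@no_bicycle 7 coloring77 3 b _ b7); last by vm_compute.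
  by move=> i j; rewrite coloring1.
apply: (@no_bicycle 7 (non coloring77) 3 b _ b7); last by vm_compute.
by move=> i j; rewrite coloring2.
Qed.

Theorem theorem1 (n : nat) (hn : 2 <= n) :
  is_BR (cycle_graph 8) (cycle_graph (2 * n)) (if n == 4 then 8 else n + 3).
Proof.
split; first by case: ifP; rewrite ?addnS.
  move=> c; pose r := color_class c color1.
  have [||bic|bic] := @has_bicycle_bound _ _ r n hn; rewrite ?card_ord //.
    by left; apply: (@mono_copy_of_bicycle _ c color1 4).
  right; apply: mono_copy_of_bicycle; apply: has_bicycle_sub bic => i j.
  by rewrite /non /r /color_class; case: (c _ _).
move=> b _ arr; case: eqP => [n4|_]; last exact: arrows_lower (ltnW hn) arr.
by apply: arrows_lower4; rewrite n4 in arr.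
Qed.
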